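(* Let $(X_i,Y_i)$, $i=1,\dots,n$, be independent pairs with $X_i$ i.i.d. uniformly distributed on $\mathcal X$ and $\mathbb E(Y_i\mid X_i)=\mathrm{tr}(X_i^\top A_0)$ for some $A_0\in\mathbb R^{m_1\times m_2}$. Assume that $\max_{i=1,\dots,n}|Y_i|\le\eta$ almost surely for some constant $\eta$. For $t>0$ let the regularization parameter $\lambda>0$ satisfy $$\lambda\ge4\eta\max\left\{\sqrt{\frac{t+\log m}{(m_1\wedge m_2)n}},\ \frac{2(t+\log m)}{n}\right\}.$$ Then with probability at least $1-e^{-t}$, $$\|\hat A^\lambda-A_0\|_2^2\le\|A-A_0\|_2^2+m_1m_2\min\left\{2\lambda\|A\|_1,\ \Big(\tfrac{1+\sqrt2}{2}\Big)^2m_1m_2\lambda^2\,\mathrm{rank}(A)\right\}$$ for all $A\in\mathbb R^{m_1\times m_2}$.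
   Context: $\mathcal X=\{e_j(m_1)e_k(m_2)^\top:1\le j\le m_1,\,1\le k\le m_2\}$, where $e_k(d)$ are the canonical basis vectors of $\mathbb R^d$; $m=m_1+m_2$; $x\wedge y=\min(x,y)$. $\|\cdot\|_1$ and $\|\cdot\|_2$ are the nuclear and Frobenius norms, $\langle A,B\rangle=\mathrm{tr}(A^\top B)$. The estimator is the (unique) minimizer $$\hat A^\lambda=\mathop{\mathrm{argmin}}_{A\in\mathbb R^{m_1\times m_2}}\left(\frac1{m_1m_2}\|A\|_2^2-\Big\langle\frac2n\sum_{i=1}^nY_iX_i,A\Big\rangle+\lambda\|A\|_1\right).$$ *)

(* Defs.v *)
From mathcomp Require Import all_boot all_order all_algebra.
From mathcomp Require Import all_classical all_reals all_analysis.
From mathcomp Require polyrcf.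
Import Order.TTheory GRing.Theory Num.Theory numFieldNormedType.Exports.

Set Implicit Arguments.
Unset Strict Implicit.
Unset Printing Implicit Defensive.

Local Open Scope classical_set_scope.
Local Open Scope ring_scope.

Section MatrixNorms.
Context {R : realType} {m1 m2 : nat}.
Implicit Types A B : 'M[R]_(m1, m2).

Definition inner_mx A B : R := \tr (A^T *m B).

Definition frobenius_norm A : R := Num.sqrt (inner_mx A A).

(* Square roots of the eigenvalues of A^T A, repeated according to their
   multiplicity as roots of the characteristic polynomial (rootsR lists the
   distinct real roots); there are m2 of them, including zeros. *)
Definition singular_values A : seq R :=
  let p := char_poly (A^T *m A) in
  flatten [seq nseq (mup x p) (Num.sqrt x) | x <- polyrcf.rootsR p].

Definition nuclear_norm A : R := \sum_(s <- singular_values A) s.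

End MatrixNorms.

Definition borel_mx (R : realType) (m1 m2 : nat) :=
  g_sigma_algebraType (@open 'M[R]_(m1, m2)).

Section Probability.
Context {d} {T : measurableType d} {R : realType} (P : probability T R).

Definition mutually_independent {d'} {T' : measurableType d'} {n : nat}
    (Z : 'I_n -> T -> T') : Prop :=
  forall (J : {set 'I_n}) (B : 'I_n -> set T'),
    (forall i, measurable (B i)) ->
    P (\bigcap_(i in [set` J]) (Z i @^-1` B i)) =
    (\prod_(i in J) P (Z i @^-1` B i))%E.

(* g (X) is a version of E(Y | X), i.e. of the conditional expectation of Y
   given the sigma-algebra {X^-1(B) : B measurable}. *)
Definition is_cond_expectation {d'} {T' : measurableType d'}
    (Y : T -> R) (X : T -> T') (g : T' -> R) : Prop :=
  [/\ measurable_fun setT g,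
      P.-integrable setT (EFin \o Y),
      P.-integrable setT (EFin \o (g \o X)) &
      forall B : set T', measurable B ->
        (\int[P]_(w in X @^-1` B) (Y w)%:E =
         \int[P]_(w in X @^-1` B) (g (X w))%:E)%E].

(* delta_mx j 0 is the j-th canonical (column) basis vector. *)
Definition uniform_on_canonical_basis {m1 m2 : nat}
    (X : {RV P >-> borel_mx R m1 m2}) : Prop :=
  forall B : set (borel_mx R m1 m2), measurable B ->
    distribution P X B =
    (\sum_(j < m1) \sum_(k < m2)
       ((m1 * m2)%:R^-1)%:E *
       \d_(((delta_mx j 0 : 'cV[R]_m1) *m (delta_mx k 0 : 'cV[R]_m2)^T)%R
            : borel_mx R m1 m2) B)%E.

End Probability.

Section Estimator.
Context {R : realType} {m1 m2 n : nat}.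

Definition penalized_risk (lambda : R) (x : 'I_n -> 'M[R]_(m1, m2))
    (y : 'I_n -> R) (A : 'M[R]_(m1, m2)) : R :=
  (m1 * m2)%:R^-1 * frobenius_norm A ^+ 2
  - inner_mx ((2 / n%:R) *: \sum_(i < n) y i *: x i) A
  + lambda * nuclear_norm A.

Definition is_minimizer (f : 'M[R]_(m1, m2) -> R) (A : 'M[R]_(m1, m2)) : Prop :=
  forall B, f A <= f B.

End Estimator.

(* Main.v *)
Require Import Defs.
From mathcomp Require Import all_boot all_order all_algebra.
From mathcomp Require Import all_classical all_reals all_analysis.
From mathcomp Require Import measurable_realfun.
From mathcomp Require polyrcf complex spectral sesquilinear.
From mathcomp Require Import ring lra.
Import (canonicals) complex.
Import Order.TTheory GRing.Theory Num.Theory numFieldNormedType.Exports.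
Local Open Scope classical_set_scope.
Local Open Scope ring_scope.

(* Write M for the noise matrix (1/n) \sum_i Y_i X_i - A0 / (m1 m2).
   If the operator norm of M is at most lambda / 2, the inequality is
   deterministic: the penalized risk is strongly convex, so its value at A
   exceeds its minimum by |A - Ahat|^2 / (m1 m2), and the nuclear norm of Ahat
   is bounded below by testing against V + (2 / lambda) P M P', V the polar factor of A
   and P, P' the projections orthogonal to its column and row spaces.

   The event |M| > lambda / 2 is controlled by a matrix Bernstein inequality for
   the self-adjoint dilations of the summands, in the style of Ahlswede and
   Winter, with (1 + H/N)^N, N = 2^k, in place of exp H: the trace inequality
   tr (AB)^N <= tr (A^N B^N) and a first-order expansion give Golden-Thompson up
   to O(1/N), independence is only needed for polynomials in the entries, and N
   tends to infinity in the final scalar inequality. *)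

Set Implicit Arguments.
Unset Strict Implicit.
Unset Printing Implicit Defensive.

(** The rank bound needs the corner term of the test matrix because the noise behaves differently on
    two pieces. The part of M that meets the column or row space of A has Frobenius norm at most
    sqrt 2 * (lambda / 2) * sqrt (rank A), while the corner P M P' has no bound in terms of the
    rank. Testing against the corner as well makes it cancel. What is left is at most lambda * (1 +
    sqrt 2) * sqrt (rank A) * |A - Ahat|, the 1 coming from the polar factor, and absorbing it into
    the strong convexity term produces ((1 + sqrt 2) / 2)^2. The minimum of m1 and m2 appears
    because an uncentered summand has a single nonzero entry in a uniform position: its two second
    moment matrices are at most eta^2 / m2 and eta^2 / m1. Measurability of Ahat is not among the
    hypotheses, yet the event has to be measurable. It depends on the sample only through the linear
    coefficient of the risk, and in a closed way, so countably many rational approximations of that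
    coefficient describe it. *)

Section SpectralTheorem.
Variable R : realType.

(** Over the complexification [S] is Hermitian, so its spectral diagonal is real. A diagonal entry
    is a root of the complexified characteristic polynomial, and the embedding of [R] is injective,
    so it is a root of the original one. *)
Lemma symmetric_eigenvalue n (S : 'M[R]_n.+1) :
  S^T = S -> exists a, eigenvalue S a.
Proof.
move=> symS.
pose C : numClosedFieldType := complex.complex (R : rcfType).
pose f : {rmorphism R -> C} := complex.real_complex R.
pose SC : 'M[C]_n.+1 := map_mx f S.
have hSC : SC \is sesquilinear.hermsymmx.
  apply: spectral.realsym_hermsym.
    apply/eqP; rewrite expr0 scale1r map_mx_id //; apply/matrixP => i j.
    by rewrite !mxE -[in LHS]symS mxE.
  apply/mxOverP => i j; rewrite !mxE; apply/complex.complex_realP.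
  by exists (S i j).
have /spectral.hermitian_normalmx/spectral.orthomx_spectralP := hSC.
have := spectral.spectral_unit SC.
have := spectral.hermitian_spectral_diag_real hSC.
set Q := spectral.spectralmx SC; set dd := spectral.spectral_diag SC.
move=> /mxOverP/(_ 0 0)/complex.complex_realP[a da] Qu SCE.
exists a; rewrite eigenvalue_root_char.
have : eigenvalue SC (f a).
  apply/eigenvalueP; exists (row 0 Q).
    have QS : Q *m SC = diag_mx dd *m Q by rewrite SCE !mulmxA mulmxV // mul1mx.
    by rewrite -row_mul QS mul_diag_mx; apply/rowP => j; rewrite !mxE da.
  apply/eqP => Q0; have : row_free Q by rewrite row_free_unit.
  move/row_freeP => [B QB].
  have := congr1 (fun M => row 0 M 0 0) QB.
  rewrite row_mul Q0 mul0mx !mxE eqxx => /esym/eqP.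
  by rewrite oner_eq0.
rewrite eigenvalue_root_char -map_char_poly /root horner_map.
by rewrite fmorph_eq0.
Qed.

Lemma dot_row_ge0 n (u : 'rV[R]_n) : 0 <= (u *m u^T) 0 0.
Proof. by rewrite mxE sumr_ge0// => j _; rewrite mxE -expr2 sqr_ge0. Qed.

Lemma dot_row_eq0 n (u : 'rV[R]_n) : (u *m u^T) 0 0 = 0 -> u = 0.
Proof.
move=> u0; apply/rowP => j; rewrite mxE; apply/eqP.
rewrite -(sqrf_eq0 (u 0 j)); apply/eqP; move: u0.
rewrite mxE (eq_bigr (fun j => u 0 j ^+ 2)) => [|k _]; last by rewrite mxE expr2.
by move=> /psumr_eq0P; apply => // k _; exact: sqr_ge0.
Qed.

(* Householder reflection exchanging v and the first basis vector. *)
Lemma orthogonal_first_row n (v : 'rV[R]_n.+1) :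
  v *m v^T = 1%:M ->
  exists Q : 'M[R]_n.+1, Q *m Q^T = 1%:M /\ delta_mx 0 0 *m Q = v.
Proof.
move=> v1; pose e : 'rV[R]_n.+1 := delta_mx 0 0.
have [ve|vne] := eqVneq v e.
  by exists 1%:M; rewrite trmx1 !mulmx1 ve.
pose w := v - e; pose q := (w *m w^T) 0 0.
have wq : w *m w^T = q%:M by rewrite [LHS]mx11_scalar.
have q0 : q != 0.
  apply: contra vne => /eqP /dot_row_eq0 w0.
  by rewrite -subr_eq0 -/w w0.
have ee : e *m e^T = 1%:M.
  by rewrite /e trmx_delta mul_delta_mx; apply/matrixP => i j; rewrite !mxE !ord1 !eqxx.
have ew : (e *m w^T) = (- (q / 2))%:M.
  have vee : v *m e^T = e *m v^T.
    by rewrite [LHS]mx11_scalar [RHS]mx11_scalar -[e *m _]trmxK trmx_mul trmxK [in RHS]mxE.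
  have evx := mx11_scalar (e *m v^T); set x := (e *m v^T) 0 0 in evx.
  have qE : q = 2 - 2 * x.
    rewrite /q /w linearB /= mulmxBl !mulmxBr v1 ee vee evx !mxE eqxx /=; ring.
  rewrite /w linearB /= mulmxBr ee evx qE -raddfB; congr (_%:M).
  by field.
have trH : (1%:M - (2 / q) *: (w^T *m w))^T = 1%:M - (2 / q) *: (w^T *m w).
  by rewrite linearB /= linearZ /= trmx1 trmx_mul trmxK.
exists (1%:M - (2 / q) *: (w^T *m w)); split.
  rewrite trH mulmxBr mulmx1 mulmxBl mul1mx -scalemxAr -scalemxAl.
  rewrite mulmxA -(mulmxA w^T) wq mul_mx_scalar -!scalemxAl !scalerA opprB.
  have -> : 2 / q * (2 / q) * q = 2 / q + 2 / q by field.
  by rewrite scalerDl addrK subrK.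
rewrite -/e mulmxBr mulmx1 -scalemxAr mulmxA ew mul_scalar_mx scalerA.
have -> : 2 / q * - (q / 2) = -1 by field.
by rewrite scaleN1r opprK /w addrC subrK.
Qed.

(** Deflation: rotate a unit eigenvector onto the first basis vector. The first row of the rotated
    matrix is then [a] times that vector, symmetry clears the first column, and the induction
    hypothesis applies to the remaining block. *)
Theorem spectral_symmetric n (S : 'M[R]_n) : S^T = S ->
  exists (Q : 'M[R]_n) (d : 'rV[R]_n),
    Q *m Q^T = 1%:M /\ S = Q^T *m diag_mx d *m Q.
Proof.
elim: n S => [|n IH] S symS.
  by exists 1%:M, 0; split; apply/matrixP => - [].
have [a /eigenvalueP[u uS u0]] := symmetric_eigenvalue symS.
pose q := (u *m u^T) 0 0.
have uq : u *m u^T = q%:M by rewrite [LHS]mx11_scalar.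
have q_gt0 : 0 < q.
  rewrite lt_def dot_row_ge0 andbT.
  by apply: contra u0 => /eqP /dot_row_eq0 ->.
pose v := (Num.sqrt q)^-1 *: u.
have v1 : v *m v^T = 1%:M.
  rewrite /v linearZ /= -scalemxAl -scalemxAr scalerA uq -invfM -expr2.
  by rewrite sqr_sqrtr ?ltW// scale_scalar_mx mulVf ?gt_eqF.
have vS : v *m S = a *: v by rewrite -scalemxAl uS !scalerA mulrC.
have [Q [OO eO]] := orthogonal_first_row v1.
have OO' := mulmx1C OO.
have [S' S'def] : exists S' : 'M[R]_(1 + n), S' = Q *m S *m Q^T by eexists.
have symS' : S'^T = S' by rewrite S'def !trmx_mul trmxK symS mulmxA.
have row0 : delta_mx 0 0 *m S' = a *: delta_mx 0 0 :> 'rV_(1+n).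
  rewrite S'def !mulmxA eO vS -eO -!scalemxAl -!mulmxA OO.
  by rewrite mulmx1.
have S'0 j : S' 0 j = a * (j == 0)%:R.
  have /matrixP/(_ 0 j) := row0; rewrite -rowE !mxE => ->.
  by rewrite eqxx /= eq_sym.
have [|Q1 [d1 [OO1 S1E]]] := IH (drsubmx S').
  by rewrite trmx_drsub symS'.
have S'E : S' = block_mx a%:M 0 0 (drsubmx S').
  rewrite -[LHS]submxK; congr block_mx.
  - rewrite [LHS]mx11_scalar !mxE /=; congr (_%:M).
    have -> : lshift n 0 = 0 :> 'I_(1 + n) by exact: val_inj.
    by rewrite S'0 eqxx mulr1.
  - apply/matrixP => i j; rewrite !mxE !ord1.
    have -> : lshift n 0 = 0 :> 'I_(1 + n) by exact: val_inj.
    by rewrite S'0 mulr0.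
  - apply/matrixP => i j; rewrite !mxE !ord1 -symS' mxE.
    have -> : lshift n 0 = 0 :> 'I_(1 + n) by exact: val_inj.
    by rewrite S'0 mulr0.
pose Q2 : 'M[R]_(1 + n) := block_mx 1%:M 0 0 Q1.
have Q2Q2 : Q2 *m Q2^T = 1%:M.
  rewrite /Q2 tr_block_mx mulmx_block !trmx0 !mulmx0 !mul0mx !addr0 add0r.
  by rewrite trmx1 mulmx1 OO1 -scalar_mx_block.
pose d : 'rV[R]_(1 + n) := row_mx a%:M d1.
have S'E2 : S' = Q2^T *m diag_mx d *m Q2.
  rewrite {1}S'E {1}S1E /Q2 /d diag_mx_row tr_block_mx !mulmx_block.
  rewrite !trmx0 !mulmx0 !mul0mx !addr0 !add0r trmx1 mulmx1 mul1mx.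
  congr block_mx; rewrite ?mul0mx//.
  by apply/matrixP => i j; rewrite !mxE !ord1 !eqxx.
exists (Q2 *m Q), d; split.
  by rewrite trmx_mul mulmxA -(mulmxA Q2) OO mulmx1.
have -> : S = Q^T *m S' *m Q.
  by rewrite S'def !mulmxA OO' mul1mx -mulmxA OO' mulmx1.
by rewrite S'E2 trmx_mul !mulmxA.
Qed.

End SpectralTheorem.

(** * Frobenius inner product and norm *)

Section InnerProduct.
Variable R : realType.

Lemma inner_mxE m n (A B : 'M[R]_(m, n)) :
  inner_mx A B = \sum_i \sum_j A i j * B i j.
Proof.
rewrite /inner_mx /mxtrace exchange_big /=; apply: eq_bigr => j _.
by rewrite mxE; apply: eq_bigr => i _; rewrite mxE.
Qed.

Lemma innerC m n (A B : 'M[R]_(m, n)) : inner_mx A B = inner_mx B A.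
Proof. by rewrite /inner_mx -mxtrace_tr trmx_mul trmxK. Qed.

Lemma innerDr m n (C A B : 'M[R]_(m, n)) :
  inner_mx C (A + B) = inner_mx C A + inner_mx C B.
Proof. by rewrite /inner_mx mulmxDr linearD. Qed.

Lemma innerDl m n (C A B : 'M[R]_(m, n)) :
  inner_mx (A + B) C = inner_mx A C + inner_mx B C.
Proof. by rewrite ![inner_mx _ C]innerC innerDr. Qed.

Lemma innerZr m n (A B : 'M[R]_(m, n)) c :
  inner_mx A (c *: B) = c * inner_mx A B.
Proof. by rewrite /inner_mx -scalemxAr linearZ. Qed.

Lemma innerZl m n (A B : 'M[R]_(m, n)) c :
  inner_mx (c *: A) B = c * inner_mx A B.
Proof. by rewrite innerC innerZr innerC. Qed.

Lemma innerNr m n (A B : 'M[R]_(m, n)) : inner_mx A (- B) = - inner_mx A B.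
Proof. by rewrite -scaleN1r innerZr mulN1r. Qed.

Lemma innerNl m n (A B : 'M[R]_(m, n)) : inner_mx (- A) B = - inner_mx A B.
Proof. by rewrite innerC innerNr innerC. Qed.

Lemma innerBr m n (C A B : 'M[R]_(m, n)) :
  inner_mx C (A - B) = inner_mx C A - inner_mx C B.
Proof. by rewrite innerDr innerNr. Qed.

Lemma innerBl m n (C A B : 'M[R]_(m, n)) :
  inner_mx (A - B) C = inner_mx A C - inner_mx B C.
Proof. by rewrite innerDl innerNl. Qed.

Lemma inner0l m n (A : 'M[R]_(m, n)) : inner_mx 0 A = 0.
Proof. by rewrite -(scale0r A) innerZl mul0r. Qed.

Lemma inner0r m n (A : 'M[R]_(m, n)) : inner_mx A 0 = 0.
Proof. by rewrite innerC inner0l. Qed.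

Lemma inner_mull m n p (A : 'M[R]_(m, n)) (B : 'M[R]_(n, p)) C :
  inner_mx (A *m B) C = inner_mx B (A^T *m C).
Proof. by rewrite /inner_mx trmx_mul mulmxA. Qed.

Lemma inner_mulr m n p (A : 'M[R]_(m, n)) (B : 'M[R]_(n, p)) C :
  inner_mx (A *m B) C = inner_mx A (C *m B^T).
Proof. by rewrite /inner_mx trmx_mul -mulmxA mxtrace_mulC mulmxA. Qed.

Lemma inner_tr m n (A B : 'M[R]_(m, n)) : inner_mx A^T B^T = inner_mx A B.
Proof. by rewrite innerC /inner_mx trmxK mxtrace_mulC. Qed.

Lemma inner_ge0 m n (A : 'M[R]_(m, n)) : 0 <= inner_mx A A.
Proof.
rewrite inner_mxE; apply: sumr_ge0 => i _; apply: sumr_ge0 => j _.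
by rewrite -expr2 sqr_ge0.
Qed.

Lemma inner_eq0 m n (A : 'M[R]_(m, n)) : inner_mx A A = 0 -> A = 0.
Proof.
rewrite inner_mxE => A0; apply/matrixP => i j; rewrite mxE; apply/eqP.
rewrite -sqrf_eq0; apply/eqP.
have sq_ge0 k l : 0 <= A k l * A k l by rewrite -expr2 sqr_ge0.
have /psumr_eq0P A0' := A0.
have /psumr_eq0P := A0' (fun k _ => sumr_ge0 _ (fun l _ => sq_ge0 k l)) i isT.
by move=> /(_ (fun l _ => sq_ge0 i l) j isT); rewrite expr2.
Qed.

Lemma sqr_fro m n (A : 'M[R]_(m, n)) : frobenius_norm A ^+ 2 = inner_mx A A.
Proof. by rewrite sqr_sqrtr ?inner_ge0. Qed.

Lemma fro_ge0 m n (A : 'M[R]_(m, n)) : 0 <= frobenius_norm A.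
Proof. exact: sqrtr_ge0. Qed.

Lemma fro0 m n : frobenius_norm (0 : 'M[R]_(m, n)) = 0.
Proof. by rewrite /frobenius_norm inner0l sqrtr0. Qed.

Lemma fro_tr m n (A : 'M[R]_(m, n)) : frobenius_norm A^T = frobenius_norm A.
Proof. by rewrite /frobenius_norm inner_tr. Qed.

Lemma froZ m n (A : 'M[R]_(m, n)) c :
  frobenius_norm (c *: A) = `|c| * frobenius_norm A.
Proof.
rewrite /frobenius_norm innerZl innerZr mulrA -expr2.
by rewrite sqrtrM ?sqr_ge0// sqrtr_sqr.
Qed.

Lemma froN m n (A : 'M[R]_(m, n)) : frobenius_norm (- A) = frobenius_norm A.
Proof. by rewrite -scaleN1r froZ normrN1 mul1r. Qed.

Lemma cauchy_schwarz m n (A B : 'M[R]_(m, n)) :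
  inner_mx A B <= frobenius_norm A * frobenius_norm B.
Proof.
have [A0|A0] := eqVneq (frobenius_norm A) 0.
  suff -> : A = 0 by rewrite inner0l fro0 mul0r.
  by apply: inner_eq0; rewrite -sqr_fro A0 expr0n.
have [B0|B0] := eqVneq (frobenius_norm B) 0.
  suff -> : B = 0 by rewrite inner0r fro0 mulr0.
  by apply: inner_eq0; rewrite -sqr_fro B0 expr0n.
have Agt0 : 0 < frobenius_norm A by rewrite lt_def A0 fro_ge0.
have Bgt0 : 0 < frobenius_norm B by rewrite lt_def B0 fro_ge0.
have := inner_ge0 (frobenius_norm B *: A - frobenius_norm A *: B).
rewrite innerBl !innerBr !innerZl !innerZr -!sqr_fro (innerC B A) => h.
rewrite -(ler_pM2l (mulr_gt0 Agt0 Bgt0)).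
by move: h; nra.
Qed.

Lemma ler_froD m n (A B : 'M[R]_(m, n)) :
  frobenius_norm (A + B) <= frobenius_norm A + frobenius_norm B.
Proof.
rewrite -(ler_pXn2r (n := 2)) ?nnegrE ?addr_ge0 ?fro_ge0//.
rewrite sqr_fro innerDl !innerDr -!sqr_fro (innerC B A).
have := cauchy_schwarz A B; nra.
Qed.

End InnerProduct.

(** * Operator norm bounds *)

Section OperatorBound.
Variable R : realType.

(** The operator norm is at most [K], as a predicate, so that no supremum is formed. When [n] is 0 a
    negative [K] qualifies, hence the sign hypotheses in some of the lemmas below. *)
Definition op_bound m n (M : 'M[R]_(m, n)) (K : R) :=
  forall u : 'cV[R]_n, frobenius_norm (M *m u) <= K * frobenius_norm u.

Lemma op_boundD m n (A B : 'M[R]_(m, n)) a b :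
  op_bound A a -> op_bound B b -> op_bound (A + B) (a + b).
Proof.
move=> Aa Bb u; rewrite mulmxDl mulrDl.
exact: le_trans (ler_froD _ _) (lerD (Aa u) (Bb u)).
Qed.

Lemma op_boundZ m n (A : 'M[R]_(m, n)) a c :
  op_bound A a -> op_bound (c *: A) (`|c| * a).
Proof.
by move=> Aa u; rewrite -scalemxAl froZ -mulrA ler_wpM2l.
Qed.

Lemma op_boundM m n p (A : 'M[R]_(m, n)) (B : 'M[R]_(n, p)) a b : 0 <= a ->
  op_bound A a -> op_bound B b -> op_bound (A *m B) (a * b).
Proof.
move=> a0 Aa Bb u; rewrite -mulmxA -mulrA.
by apply: le_trans (Aa _) _; rewrite ler_wpM2l.
Qed.

Lemma op_boundN m n (A : 'M[R]_(m, n)) a : op_bound A a -> op_bound (- A) a.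
Proof. by move=> Aa u; rewrite mulNmx froN; exact: Aa. Qed.

Lemma op_bound1 n : op_bound (1%:M : 'M[R]_n) 1.
Proof. by move=> u; rewrite mul1mx mul1r. Qed.

Lemma op_bound_le m n (A : 'M[R]_(m, n)) a b :
  a <= b -> op_bound A a -> op_bound A b.
Proof.
by move=> ab Aa u; apply: le_trans (Aa u) _; rewrite ler_wpM2r// fro_ge0.
Qed.

Lemma op_boundX n (A : 'M[R]_n) a k : 0 <= a ->
  op_bound A a -> op_bound (A ^+ k) (a ^+ k).
Proof.
move=> a0 Aa; elim: k => [|k IH] /=; first exact: op_bound1.
by rewrite [A ^+ _]exprS exprS; exact: op_boundM.
Qed.

(** The square of |A^T u| is <u, A A^T u>, at most |u| * a * |A^T u|; divide by |A^T u|. *)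
Lemma op_bound_tr m n (A : 'M[R]_(m, n)) a : 0 <= a ->
  op_bound A a -> op_bound A^T a.
Proof.
move=> a0 Aa u; have [->|] := eqVneq (frobenius_norm (A^T *m u)) 0.
  by rewrite mulr_ge0 ?fro_ge0.
move=> n0; have ngt0 : 0 < frobenius_norm (A^T *m u).
  by rewrite lt_def n0 fro_ge0.
rewrite -(ler_pM2l ngt0) -expr2 sqr_fro inner_mull trmxK.
apply: le_trans (cauchy_schwarz _ _) _.
rewrite mulrC mulrCA mulrA ler_wpM2r ?fro_ge0//.
Qed.

Lemma sqr_fro_col m n (A : 'M[R]_(m, n)) :
  frobenius_norm A ^+ 2 = \sum_j frobenius_norm (col j A) ^+ 2.
Proof.
rewrite sqr_fro inner_mxE exchange_big /=; apply: eq_bigr => j _.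
rewrite sqr_fro inner_mxE; apply: eq_bigr => i _.
by rewrite big_ord1 !mxE.
Qed.

Lemma op_bound_fro m n p (A : 'M[R]_(m, n)) a (B : 'M[R]_(n, p)) : 0 <= a ->
  op_bound A a -> frobenius_norm (A *m B) <= a * frobenius_norm B.
Proof.
move=> a0 Aa; rewrite -(ler_pXn2r (n := 2)) ?nnegrE ?mulr_ge0 ?fro_ge0//.
rewrite exprMn !sqr_fro_col mulr_sumr; apply: ler_sum => j _.
rewrite colE -mulmxA -colE -exprMn.
by rewrite lerXn2r ?nnegrE ?mulr_ge0 ?fro_ge0.
Qed.

(** After transposition the roles swap: [u^T] acts on the columns of [A^T] with operator norm at
    most |u|, by Cauchy-Schwarz. *)
Lemma op_bound_self m n (A : 'M[R]_(m, n)) : op_bound A (frobenius_norm A).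
Proof.
move=> u; rewrite -fro_tr trmx_mul -[frobenius_norm A]fro_tr mulrC.
apply: op_bound_fro; first exact: fro_ge0.
move=> v; have -> : u^T *m v = inner_mx u v *: 1%:M.
  by rewrite [LHS]mx11_scalar scalemx1 /inner_mx /mxtrace big_ord1.
rewrite froZ; have -> : frobenius_norm (1%:M : 'M[R]_1) = 1.
  by rewrite /frobenius_norm /inner_mx trmx1 mulmx1 mxtrace1 sqrtr1.
have := cauchy_schwarz u v; have := cauchy_schwarz (- u) v.
by rewrite innerNl froN mulr1 ler_norml => h1 h2; apply/andP; split; lra.
Qed.

End OperatorBound.

(** * Singular values, trace duality and the polar factor *)

Section NuclearNorm.
Variable R : realType.

Lemma char_poly_orthogonal n (Q : 'M[R]_n) (d : 'rV[R]_n) : Q *m Q^T = 1%:M ->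
  char_poly (Q^T *m diag_mx d *m Q) = \prod_i ('X - (d 0 i)%:P).
Proof.
move=> QQ; have QQ' := mulmx1C QQ.
pose q := map_mx polyC Q.
have qq : q^T *m q = 1%:M by rewrite /q map_trmx -map_mxM QQ' map_mx1.
have -> : char_poly (Q^T *m diag_mx d *m Q) = char_poly (diag_mx d).
  rewrite /char_poly.
  have -> : char_poly_mx (Q^T *m diag_mx d *m Q)
      = q^T *m char_poly_mx (diag_mx d) *m q.
    rewrite /char_poly_mx mulmxBr mulmxBl !map_mxM -map_trmx -/q; congr (_ - _).
    by rewrite -mulmxA mul_scalar_mx -scalemxAr qq scalemx1.
  by rewrite !det_mulmx mulrAC -det_mulmx qq det1 mul1r.
rewrite char_poly_trig; last first.
  by apply/is_trig_mxP => i j ij; rewrite !mxE (_ : i == j = false)// lt_eqF.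
by apply: eq_bigr => i _; rewrite !mxE eqxx mulr1n.
Qed.

(** Connects [singular_values] with any explicit list of eigenvalues: for a split polynomial the
    multiplicity of a root is its number of occurrences in the list. *)
Lemma sum_roots_mup (p : {poly R}) (s : seq R) (f : R -> R) :
  p = \prod_(y <- s) ('X - y%:P) ->
  \sum_(x <- flatten [seq nseq (mup x p) (f x) | x <- polyrcf.rootsR p]) x
  = \sum_(y <- s) f y.
Proof.
move=> pE; rewrite big_flatten /= big_map.
transitivity (\sum_(x <- undup s) f x *+ count_mem x s); last first.
  rewrite -[RHS]big_undup_iterop_count; apply: eq_bigr => x _.
  by case: (count_mem x s) => //= k; rewrite -iteropE.
have pn0 : p != 0.
  by rewrite pE; apply: monic_neq0; apply: monic_prod_XsubC.
rewrite (perm_big (undup s)); last first.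
  apply: uniq_perm; [exact: polyrcf.uniq_roots|exact: undup_uniq|].
  move=> x; rewrite mem_undup -polyrcf.roots_on_rootsR// in_itv /=.
  by rewrite pE root_prod_XsubC.
apply: eq_bigr => x _; rewrite pE mu_prod_XsubC.
elim: (count_mem x s) => [|k IH] /=; first by rewrite big_nil mulr0n.
by rewrite big_cons IH mulrS.
Qed.

(** A singular value decomposition whose left factor is not normalized: the columns of [B] are
    orthogonal and their lengths are the singular values. Zero singular values then need no special
    treatment. *)
Lemma nuclear_svd m n (A : 'M[R]_(m, n)) :
  exists (B : 'M[R]_(m, n)) (Q : 'M[R]_n) (d : 'rV[R]_n),
    [/\ Q *m Q^T = 1%:M, A = B *m Q, B^T *m B = diag_mx d,
        forall i, d 0 i = frobenius_norm (col i B) ^+ 2 &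
        nuclear_norm A = \sum_i Num.sqrt (d 0 i)].
Proof.
have [|Q [d [QQ SE]]] := @spectral_symmetric R n (A^T *m A).
  by rewrite trmx_mul trmxK.
have QQ' := mulmx1C QQ.
have BB : (A *m Q^T)^T *m (A *m Q^T) = diag_mx d.
  rewrite trmx_mul trmxK mulmxA -(mulmxA Q) SE !mulmxA QQ mul1mx.
  by rewrite -mulmxA QQ mulmx1.
exists (A *m Q^T), Q, d; split => //.
- by rewrite -mulmxA QQ' mulmx1.
- move=> i; have /matrixP/(_ i i) := BB.
  rewrite [in RHS]mxE eqxx mulr1n => <-; rewrite sqr_fro inner_mxE mxE.
  by apply: eq_bigr => k _; rewrite big_ord1 !mxE.
- rewrite /nuclear_norm /singular_values.
  rewrite (@sum_roots_mup _ [seq d 0 i | i <- enum 'I_n] Num.sqrt).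
    by rewrite big_map big_enum.
  by rewrite big_map big_enum /= SE char_poly_orthogonal.
Qed.

Lemma inner_col m n (A B : 'M[R]_(m, n)) :
  inner_mx A B = \sum_j inner_mx (col j A) (col j B).
Proof.
rewrite inner_mxE exchange_big /=; apply: eq_bigr => j _.
by rewrite inner_mxE; apply: eq_bigr => i _; rewrite big_ord1 !mxE.
Qed.

(** Rotated by [Q], the inner product splits over the columns of [B]. Each is paired with the image
    under [W] of a unit vector, and the lengths of the columns of [B] sum to the nuclear norm. *)
Lemma nuclear_dual m n (W A : 'M[R]_(m, n)) K : op_bound W K ->
  inner_mx W A <= K * nuclear_norm A.
Proof.
move=> WK; have [B [Q [d [QQ -> BB dE ->]]]] := nuclear_svd A.
rewrite innerC inner_mulr inner_col mulr_sumr; apply: ler_sum => i _.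
apply: le_trans (cauchy_schwarz _ _) _.
rewrite dE sqrtr_sqr ger0_norm ?fro_ge0// mulrC ler_wpM2r ?fro_ge0//.
rewrite colE -mulmxA -colE; apply: le_trans (WK _) _.
suff -> : frobenius_norm (col i Q^T) = 1 by rewrite mulr1.
have /matrixP/(_ i i) := QQ; rewrite !mxE eqxx /= => q1.
suff q2 : inner_mx (col i Q^T) (col i Q^T) = 1 by rewrite /frobenius_norm q2 sqrtr1.
rewrite inner_mxE; etransitivity; last exact: q1.
by apply: eq_bigr => k _; rewrite big_ord1 !mxE.
Qed.

(** The columns of [B] with nonzero [d] are independent, because their Gram matrix is diagonal with
    nonzero entries. *)
Lemma card_le_rank m n (B : 'M[R]_(m, n)) (d : 'rV[R]_n) :
  B^T *m B = diag_mx d -> (\sum_i (d 0 i != 0)%:R : R) <= (\rank B)%:R.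
Proof.
move=> BB; rewrite -natr_sum ler_nat.
rewrite (eq_bigr (fun i => if d 0 i != 0 then 1%N else 0%N)); last first.
  by move=> i _; case: eqP.
rewrite -big_mkcond sum1_card; set D := [pred i | d 0 i != 0].
pose f (k : 'I_#|D|) := enum_val k.
pose C := rowsub f B^T.
have CE : C = rowsub f 1%:M *m B^T by rewrite mul_rowsub_mx mul1mx.
have : row_free C.
  rewrite /row_free eqn_leq rank_leq_row /=.
  suff u : C *m C^T \in unitmx.
    by rewrite -{1}(mxrank_unit u) mxrankM_maxl.
  have -> : C *m C^T = diag_mx (\row_k d 0 (f k)).
    apply/matrixP => k l; have /matrixP/(_ (f k) (f l)) := BB.
    rewrite !mxE (inj_eq enum_val_inj) => <-.
    by apply: eq_bigr => j _; rewrite !mxE.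
  rewrite unitmxE det_diag unitfE; apply/prodf_neq0 => k _; rewrite mxE.
  by have := enum_valP k; rewrite inE.
move/eqP => <-; rewrite -(mxrank_tr B) CE; exact: mxrankM_maxr.
Qed.

(* The polar factor V of A; V^T V projects onto the row space of A. *)
Lemma polar_factor m n (A : 'M[R]_(m, n)) :
  exists V : 'M[R]_(m, n),
    [/\ inner_mx V A = nuclear_norm A, A *m (V^T *m V) = A,
        V *m (V^T *m V) = V & frobenius_norm V ^+ 2 <= (\rank A)%:R].
Proof.
have [B [Q [d [QQ AE BB dE ->]]]] := nuclear_svd A.
have QQ' := mulmx1C QQ.
(* Since the inverse of 0 is 0, [e] is the pseudo-inverse of the singular values, and [z] is the
   indicator of the nonzero ones. *)
pose e : 'rV[R]_n := \row_i (Num.sqrt (d 0 i))^-1.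
pose z : 'rV[R]_n := \row_i (d 0 i != 0)%:R.
have dd i : Num.sqrt (d 0 i) * Num.sqrt (d 0 i) = d 0 i.
  by rewrite -expr2 sqr_sqrtr// dE exprn_ge0 ?fro_ge0.
have s0 i : (Num.sqrt (d 0 i) == 0) = (d 0 i == 0).
  by rewrite -[in RHS]dd mulf_eq0 orbb.
have ed i : e 0 i * d 0 i = Num.sqrt (d 0 i).
  rewrite mxE -[X in _ * X]dd; have [->|n0] := eqVneq (Num.sqrt (d 0 i)) 0.
    by rewrite !mulr0.
  by rewrite mulrA mulVf// mul1r.
have es i : e 0 i * Num.sqrt (d 0 i) = z 0 i.
  rewrite !mxE -s0; have [->|n0] := eqVneq (Num.sqrt (d 0 i)) 0.
    by rewrite !mulr0.
  by rewrite mulVf.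
pose V := B *m diag_mx e *m Q.
have VV : V^T *m V = Q^T *m diag_mx z *m Q.
  rewrite /V !trmx_mul tr_diag_mx !mulmxA; congr (_ *m _).
  rewrite -!mulmxA; congr (_ *m _); rewrite !mulmxA -(mulmxA _ B^T) BB.
  rewrite !mulmx_diag; congr diag_mx; apply/rowP => i.
  by rewrite 2!mxE ed mulrC es.
have zQ M : M *m Q *m (Q^T *m diag_mx z *m Q) = M *m diag_mx z *m Q.
  by rewrite !mulmxA -(mulmxA M) QQ mulmx1.
exists V; split.
- rewrite /V AE inner_mulr -mulmxA QQ mulmx1 inner_mull BB.
  rewrite /inner_mx tr_diag_mx mulmx_diag mxtrace_diag.
  by apply: eq_bigr => i _; rewrite mxE ed.
- rewrite VV {1}AE zQ AE; congr (_ *m _); apply/matrixP => i j.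
  rewrite mul_mx_diag !mxE; case: eqVneq => [d0|]; last by rewrite mulr1.
  have : col j B = 0.
    by apply/inner_eq0; rewrite -sqr_fro -dE.
  by move/matrixP/(_ i 0); rewrite !mxE => ->; rewrite mul0r.
- rewrite VV /V zQ; congr (_ *m _); rewrite -mulmxA mulmx_diag; congr (_ *m _).
  congr diag_mx; apply/rowP => i; rewrite mxE -es !mxE.
  have [->|n0] := eqVneq (Num.sqrt (d 0 i)) 0; first by rewrite invr0 !mul0r.
  by rewrite mulVf// mulr1.
- rewrite sqr_fro /inner_mx VV -mulmxA mxtrace_mulC -mulmxA QQ mulmx1.
  rewrite /mxtrace; apply: (@le_trans _ _ (\rank B)%:R).
    apply: le_trans (card_le_rank BB).
    by apply: ler_sum => i _; rewrite !mxE eqxx mulr1n.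
  rewrite ler_nat AE mxrankMfree// row_free_unit.
  by have [] := mulmx1_unit QQ.
Qed.

End NuclearNorm.

(** * Partial isometries, their complementary projections, and convexity of the nuclear norm *)

Section PartialIsometry.
Variable R : realType.

Lemma partial_isometry_tr m n (V : 'M[R]_(m, n)) :
  V *m (V^T *m V) = V -> V^T *m (V^T^T *m V^T) = V^T.
Proof. by move=> VV; rewrite trmxK -[in RHS]VV !trmx_mul trmxK mulmxA. Qed.

(** [V *m V^T] is the orthogonal projection onto the column space of [V], and the projection of [x]
    has the same norm as [V^T *m x]. *)
Lemma fro_compl m n p (V : 'M[R]_(m, n)) (x : 'M[R]_(m, p)) :
  V *m (V^T *m V) = V ->
  frobenius_norm (x - V *m V^T *m x) ^+ 2
  = frobenius_norm x ^+ 2 - frobenius_norm (V^T *m x) ^+ 2.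
Proof.
move=> VV; have VV' := partial_isometry_tr VV; rewrite trmxK in VV'.
rewrite !sqr_fro innerBl !innerBr -mulmxA.
have -> : inner_mx x (V *m (V^T *m x)) = inner_mx (V^T *m x) (V^T *m x).
  by rewrite innerC inner_mull.
have -> : inner_mx (V *m (V^T *m x)) x = inner_mx (V^T *m x) (V^T *m x).
  by rewrite inner_mull.
have -> : inner_mx (V *m (V^T *m x)) (V *m (V^T *m x))
    = inner_mx (V^T *m x) (V^T *m x).
  by rewrite inner_mull !mulmxA -(mulmxA V^T V) VV'.
by rewrite subrr subr0.
Qed.

Lemma inner_compl m n p (V : 'M[R]_(m, n)) (y : 'M[R]_(n, p)) x :
  V *m (V^T *m V) = V -> inner_mx (V *m y) (x - V *m V^T *m x) = 0.
Proof.
move=> VV; have VV' := partial_isometry_tr VV; rewrite trmxK in VV'.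
by rewrite innerBr !inner_mull !mulmxA -(mulmxA V^T V) VV' subrr.
Qed.

Lemma fro_pythagoras m n (A B : 'M[R]_(m, n)) : inner_mx A B = 0 ->
  frobenius_norm (A + B) ^+ 2 = frobenius_norm A ^+ 2 + frobenius_norm B ^+ 2.
Proof.
by move=> AB; rewrite !sqr_fro innerDl !innerDr (innerC B A) AB addr0 add0r.
Qed.

(** The two terms have orthogonal ranges, and they see complementary components of [u]: the first
    has length |V u|, the second at most |y|, and the squares of |V u| and |y| add up to that of
    |u|. *)
Lemma op_bound_dilate m n (V W : 'M[R]_(m, n)) :
  V *m (V^T *m V) = V -> op_bound W 1 ->
  op_bound (V + (1%:M - V *m V^T) *m W *m (1%:M - V^T *m V)) 1.
Proof.
move=> VV W1 u; have VV' := partial_isometry_tr VV.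
rewrite mul1r -(ler_pXn2r (n := 2)) ?nnegrE ?fro_ge0//.
set y := (1%:M - V^T *m V) *m u.
have -> : (V + (1%:M - V *m V^T) *m W *m (1%:M - V^T *m V)) *m u
   = V *m u + (W *m y - V *m V^T *m (W *m y)).
  rewrite [LHS]mulmxDl; congr (_ + _); rewrite -(mulmxA _ _ u) -/y -(mulmxA _ W).
  by rewrite [LHS]mulmxBl mul1mx.
rewrite fro_pythagoras ?inner_compl// fro_compl//.
have ly : frobenius_norm (W *m y) ^+ 2 <= frobenius_norm y ^+ 2.
  by rewrite lerXn2r ?nnegrE ?fro_ge0//; apply: le_trans (W1 _) _; rewrite mul1r.
have := fro_compl u VV'; rewrite trmxK.
rewrite -[u in u - _]mul1mx -mulmxBl -/y.
have := sqr_ge0 (frobenius_norm (V^T *m (W *m y))).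
by move: ly; lra.
Qed.

Lemma op_bound_partial_isometry m n (V : 'M[R]_(m, n)) :
  V *m (V^T *m V) = V -> op_bound V 1.
Proof.
move=> VV; have W0 : op_bound (0 : 'M[R]_(m, n)) 1.
  by move=> u; rewrite mul0mx fro0 mul1r fro_ge0.
by have := op_bound_dilate VV W0; rewrite mulmx0 mul0mx addr0.
Qed.

(** Outside the corner, [M] splits into its part with columns in the range of [V] and the rest,
    composed with [V^T *m V]. The two are orthogonal and each has norm at most K |V|; this is the
    origin of sqrt 2. *)
Lemma fro_cornerC m n (V M : 'M[R]_(m, n)) K :
  0 <= K -> op_bound M K -> V *m (V^T *m V) = V ->
  frobenius_norm (M - (1%:M - V *m V^T) *m M *m (1%:M - V^T *m V)) ^+ 2
  <= 2 * (K ^+ 2 * frobenius_norm V ^+ 2).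
Proof.
move=> K0 MK VV; have VV' := partial_isometry_tr VV; rewrite trmxK in VV'.
have -> : M - (1%:M - V *m V^T) *m M *m (1%:M - V^T *m V)
   = V *m (V^T *m M) + (M *m (V^T *m V) - V *m V^T *m (M *m (V^T *m V))).
  rewrite mulmxBr mulmx1 !mulmxBl !mul1mx !mulmxA.
  by apply/matrixP => i j; rewrite !mxE; ring.
rewrite fro_pythagoras ?inner_compl// fro_compl//.
have op_le p q (A : 'M[R]_(p, q)) (B : 'M[R]_(q, p)) :
    op_bound A K -> frobenius_norm (A *m B) ^+ 2 <= K ^+ 2 * frobenius_norm B ^+ 2.
  move=> AK; rewrite -exprMn lerXn2r ?nnegrE ?mulr_ge0 ?fro_ge0//.
  exact: op_bound_fro.
have M2 : frobenius_norm (M *m (V^T *m V)) ^+ 2 <= K ^+ 2 * frobenius_norm V ^+ 2.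
  rewrite mulmxA -[frobenius_norm V in leRHS]fro_tr.
  apply: le_trans (_ : _ <= frobenius_norm (M *m V^T) ^+ 2) _; last exact: op_le.
  rewrite -[leRHS]mul1r -[1 in leRHS](expr1n _ 2) -exprMn.
  rewrite lerXn2r ?nnegrE ?mulr_ge0 ?fro_ge0//.
  rewrite -fro_tr -[frobenius_norm (M *m V^T) in leRHS]fro_tr trmx_mul.
  by apply: op_bound_fro => //; apply: op_bound_tr => //; exact: op_bound_partial_isometry.
have M1 : frobenius_norm (V *m (V^T *m M)) ^+ 2 <= K ^+ 2 * frobenius_norm V ^+ 2.
  apply: le_trans (_ : _ <= frobenius_norm (V^T *m M) ^+ 2) _.
    rewrite -[leRHS]mul1r -[1 in leRHS](expr1n _ 2) -exprMn.
    rewrite lerXn2r ?nnegrE ?mulr_ge0 ?fro_ge0//.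
    by apply: op_bound_fro => //; exact: op_bound_partial_isometry.
  rewrite -fro_tr trmx_mul trmxK; apply: op_le; exact: op_bound_tr.
have := sqr_ge0 (frobenius_norm (V^T *m (M *m (V^T *m V)))).
by move: M1 M2; lra.
Qed.

(** The polar factor of the combination is a linear functional that attains the nuclear norm there
    and is dominated by it at [A] and [B]. *)
Lemma nuclear_convex m n (A B : 'M[R]_(m, n)) s : 0 <= s <= 1 ->
  nuclear_norm ((1 - s) *: A + s *: B)
  <= (1 - s) * nuclear_norm A + s * nuclear_norm B.
Proof.
move=> /andP[s0 s1]; set C := _ + _.
have [V [<- _ /op_bound_partial_isometry V1 _]] := polar_factor C.
rewrite /C innerDr !innerZr.
have := nuclear_dual A V1; have := nuclear_dual B V1; rewrite !mul1r => hB hA.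
by apply: lerD; apply: ler_wpM2l => //; rewrite subr_ge0.
Qed.

End PartialIsometry.

(** * The deterministic oracle inequality *)

Section Oracle.
Variable R : realType.
Variables m n : nat.
Implicit Types A B G M : 'M[R]_(m, n).

(** Keeps the linear coefficient [G] as a parameter, so that the noise can be isolated in it and
    minimizers for different samples can be compared. *)
Definition risk (mu : R) G (lam : R) A : R :=
  mu * frobenius_norm A ^+ 2 - inner_mx G A + lam * nuclear_norm A.

(** Compare [Ah] with the point [(1 - s) *: Ah + s *: A]: the quadratic part gains
    [s * (1 - s) * (mu * d)]. Divide by [s] and let [s] tend to 0. *)
Lemma minimizer_strong mu G lam Ah : 0 < mu -> 0 <= lam ->
  is_minimizer (risk mu G lam) Ah ->
  forall A, risk mu G lam Ah + mu * frobenius_norm (A - Ah) ^+ 2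
            <= risk mu G lam A.
Proof.
move=> mu0 lam0 minA A.
set d := frobenius_norm (A - Ah) ^+ 2; have d0 : 0 <= d by rewrite exprn_ge0 ?fro_ge0.
have key s : 0 < s -> s < 1 ->
    risk mu G lam Ah + (1 - s) * (mu * d) <= risk mu G lam A.
  move=> s0 s1; have := minA ((1 - s) *: Ah + s *: A).
  have s01 : 0 <= s <= 1 by rewrite !ltW.
  have := ler_wpM2l lam0 (nuclear_convex Ah A s01).
  rewrite /risk.
  have -> : frobenius_norm ((1 - s) *: Ah + s *: A) ^+ 2 = (1 - s) * frobenius_norm Ah ^+ 2
      + s * frobenius_norm A ^+ 2 - s * (1 - s) * d.
    rewrite /d !sqr_fro !(innerBl, innerBr, innerDl, innerDr, innerZl, innerZr).
    by rewrite (innerC A Ah); ring.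
  rewrite innerDr !innerZr => h1 h2; rewrite -(ler_pM2l s0).
  by move: h1 h2; lra.
rewrite leNgt; apply/negP; set D := risk _ _ _ A => lt0.
have lt1 : risk mu G lam Ah <= D by exact: minA.
have md0 : 0 < mu * d by rewrite -(ltrD2l (risk mu G lam Ah)) addr0; exact: le_lt_trans lt1 lt0.
pose e := risk mu G lam Ah + mu * d - D.
have e0 : 0 < e by rewrite subr_gt0.
have ed : e <= mu * d by rewrite /e; move: lt1; lra.
(* Instead of a limit, one [s] whose cost [s * (mu * d)] is half of the presumed violation [e]. *)
have s0 : 0 < e / (2 * (mu * d)) by rewrite divr_gt0// mulr_gt0.
have s1 : e / (2 * (mu * d)) < 1.
  have h (x y : R) : 0 < y -> x <= y -> x / (2 * y) < 1.
    by move=> y0 xy; rewrite ltr_pdivrMr ?mulr_gt0//; lra.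
  exact: h.
have := key _ s0 s1.
have -> : (1 - e / (2 * (mu * d))) * (mu * d) = mu * d - e / 2.
  by field; rewrite !gt_eqF// -(pmulr_lgt0 _ mu0) mulrC.
by rewrite -/D; move: e0; rewrite /e; lra.
Qed.

Lemma oracle_inequality mu lam A0 M Ah : 0 < mu -> 0 < lam ->
  op_bound M (lam / 2) ->
  is_minimizer (risk mu (2 *: (mu *: A0 + M)) lam) Ah ->
  forall A, frobenius_norm (Ah - A0) ^+ 2 <= frobenius_norm (A - A0) ^+ 2 +
    mu^-1 * Num.min (2 * lam * nuclear_norm A)
      (((1 + Num.sqrt 2) / 2) ^+ 2 * mu^-1 * lam ^+ 2 * (\rank A)%:R).
Proof.
move=> mu0 lam0 MK minA A; have l20 : 0 <= lam / 2 by rewrite divr_ge0// ltW.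
(* Completing the square: up to a constant, the risk is the squared distance to [A0], a noise term
   and the penalty. *)
have riskE X : risk mu (2 *: (mu *: A0 + M)) lam X = mu * frobenius_norm (X - A0) ^+ 2
     - mu * frobenius_norm A0 ^+ 2 - 2 * inner_mx M X + lam * nuclear_norm X.
  rewrite /risk !sqr_fro !(innerBl, innerBr, innerDl, innerDr, innerZl, innerZr).
  by rewrite (innerC X A0); ring.
have basic := minimizer_strong mu0 (ltW lam0) minA A.
rewrite !riskE in basic.
have mu_n0 : mu != 0 by rewrite gt_eqF.
rewrite -(ler_pM2l mu0) mulrDr mulVKf//.
(* Both bounds hold, so the comparison deciding the minimum is dropped. For the nuclear norm bound,
   duality lets the noise cost at most lam times each of the two nuclear norms. *)
rewrite minEle; case: ifP => _.
  have h1 := nuclear_dual Ah MK.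
  have h2 := nuclear_dual A (op_boundN MK); rewrite innerNl in h2.
  have : 0 <= mu * frobenius_norm (A - Ah) ^+ 2.
    by rewrite mulr_ge0 ?exprn_ge0 ?fro_ge0// ltW.
  by move: basic h1 h2; lra.
have [V [VA AP VV Vr]] := polar_factor A.
pose N := (1%:M - V *m V^T) *m M *m (1%:M - V^T *m V).
have W1 : op_bound ((2 / lam) *: M) 1.
  have l1 : `|2 / lam| * (lam / 2) = 1.
    by rewrite ger0_norm ?divr_ge0 ?ltW//; field; rewrite gt_eqF.
  by have := op_boundZ (2 / lam) MK; rewrite l1.
have h1 := nuclear_dual Ah (op_bound_dilate VV W1).
rewrite -scalemxAr -scalemxAl -/N mul1r innerDl innerZl in h1.
(* The corner does not see [A], because [A] vanishes on the complement of its row space. *)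
have NA : inner_mx N A = 0.
  rewrite /N inner_mulr linearB /= trmx1 trmx_mul trmxK mulmxBr mulmx1 AP.
  by rewrite subrr inner0r.
(* The noise outside the corner contributes sqrt 2 * lam and the polar factor contributes lam, both
   times |V|; their sum is [lam * w]. *)
have h2 : 2 * inner_mx (M - N) (Ah - A) - lam * inner_mx V (Ah - A) <=
    (2 * (lam / 2 * Num.sqrt 2 * frobenius_norm V) + lam * frobenius_norm V)
      * frobenius_norm (Ah - A).
  rewrite [leRHS]mulrDl; apply: lerD.
    rewrite -mulrA ler_wpM2l//; apply: le_trans (cauchy_schwarz _ _) _.
    rewrite ler_wpM2r ?fro_ge0//.
    rewrite -(ler_pXn2r (n := 2)) ?nnegrE ?mulr_ge0 ?fro_ge0 ?sqrtr_ge0 ?(ltW lam0)//.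
    have := fro_cornerC l20 MK VV; rewrite -/N.
    have -> // : (lam / 2 * Num.sqrt 2 * frobenius_norm V) ^+ 2
       = 2 * ((lam / 2) ^+ 2 * frobenius_norm V ^+ 2).
    by rewrite exprMn [X in X * _]exprMn sqr_sqrtr//; ring.
  by have := ler_wpM2l (ltW lam0) (cauchy_schwarz (- V) (Ah - A)); rewrite innerNl froN; lra.
have h3 : lam * (nuclear_norm A - nuclear_norm Ah)
   <= - lam * inner_mx V (Ah - A) - 2 * inner_mx N (Ah - A).
  move: (ler_wpM2l (ltW lam0) h1); rewrite !innerBr NA VA mulrDr mulrA.
  by rewrite (_ : lam * (2 / lam) = 2); [lra|field; rewrite gt_eqF].
rewrite -[frobenius_norm (Ah - A)]froN opprB in h2.
set b := frobenius_norm (A - Ah) in basic h2.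
set v := frobenius_norm V in h2 Vr.
set w := 1 + Num.sqrt 2.
have h4 : mu * frobenius_norm (Ah - A0) ^+ 2 + mu * b ^+ 2
    <= mu * frobenius_norm (A - A0) ^+ 2 + lam * w * v * b.
  by move: basic h2 h3; rewrite /w innerBl (innerBr M); lra.
(* Arithmetic-geometric inequality weighted so that its quadratic part is exactly the strong
   convexity term [mu * b ^+ 2]. *)
have h5 : lam * w * v * b <= mu * b ^+ 2 + (w / 2) ^+ 2 * mu^-1 * lam ^+ 2 * v ^+ 2.
  have : 0 <= mu * (b - lam * w * v / (2 * mu)) ^+ 2 by rewrite mulr_ge0 ?sqr_ge0 ?ltW.
  rewrite (_ : mu * _ ^+ 2 = mu * b ^+ 2 - lam * w * v * b
      + (w / 2) ^+ 2 * mu^-1 * lam ^+ 2 * v ^+ 2); first lra.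
  by field; rewrite gt_eqF.
have h6 : (w / 2) ^+ 2 * mu^-1 * lam ^+ 2 * v ^+ 2 <= (w / 2) ^+ 2 * mu^-1 * lam ^+ 2 * (\rank A)%:R.
  apply: ler_wpM2l => //; apply: mulr_ge0; rewrite ?sqr_ge0//.
  by apply: mulr_ge0; rewrite ?sqr_ge0// invr_ge0 ltW.
by move: h4 h5 h6; lra.
Qed.

(* Add the strong convexity inequalities at the two minimizers. *)
Lemma minimizer_lipschitz mu lam G G' Ah Ah' : 0 < mu -> 0 <= lam ->
  is_minimizer (risk mu G lam) Ah -> is_minimizer (risk mu G' lam) Ah' ->
  frobenius_norm (Ah' - Ah) <= (2 * mu)^-1 * frobenius_norm (G' - G).
Proof.
move=> mu0 lam0 m1 m2.
have h1 := minimizer_strong mu0 lam0 m1 Ah'.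
have h2 := minimizer_strong mu0 lam0 m2 Ah.
rewrite -froN opprB in h2; set d := frobenius_norm (Ah' - Ah) in h1 h2 *.
have h3 := cauchy_schwarz (G' - G) (Ah' - Ah).
rewrite -/d !(innerBl, innerBr) in h3.
have [->|d0] := eqVneq d 0; first by rewrite mulr_ge0 ?fro_ge0// invr_ge0 mulr_ge0// ltW.
have dgt0 : 0 < d by rewrite lt_def d0 fro_ge0.
rewrite ler_pdivlMl ?mulr_gt0// -(ler_pM2r dgt0).
by move: h1 h2 h3; rewrite /risk; lra.
Qed.

End Oracle.

(** * Trace inequalities for products of symmetric matrices *)

Section TracePowers.
Variable R : realType.
Variable m : nat.
Implicit Types A B X P Q : 'M[R]_m.

Lemma trmxX A k : (A ^+ k)^T = A^T ^+ k.
Proof.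
elim: k => [|k IH]; first by rewrite !expr0 trmx1.
by rewrite [A ^+ _]exprS [A^T ^+ _]exprSr -!mulmxE trmx_mul IH.
Qed.

Lemma exprM_cyc A B k : (A * B) ^+ k.+1 = A * (B * A) ^+ k * B.
Proof.
elim: k => [|k IH]; first by rewrite expr1 expr0 mulr1.
by rewrite exprS IH [(B * A) ^+ k.+1]exprS !mulrA.
Qed.

Lemma mxtrace_exprM A B k : \tr ((A * B) ^+ k) = \tr ((B * A) ^+ k).
Proof.
case: k => [|k]; first by rewrite !expr0.
by rewrite exprM_cyc -mulmxE mxtrace_mulC mulmxE mulrA -exprS.
Qed.

Lemma mxtrace_mul_le A B : \tr (A * B) <= (\tr (A * A^T) + \tr (B * B^T)) / 2.
Proof.
have -> : \tr (A * B) = inner_mx A^T B by rewrite /inner_mx trmxK.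
have -> : \tr (A * A^T) = inner_mx A^T A^T by rewrite /inner_mx trmxK.
have -> : \tr (B * B^T) = inner_mx B B by rewrite /inner_mx mxtrace_mulC.
have := inner_ge0 (A^T - B).
rewrite innerBl !innerBr (innerC B); lra.
Qed.

(* The two families of inequalities are proved together, doubling the exponent:
   the first for X follows from the first for X^2 and the second for X^T X and
   X X^T; the second for P, Q from the first for PQ and the second for P^2, Q^2. *)
Lemma mxtrace_pow2_le k :
  (forall X, \tr (X ^+ (2 * 2 ^ k)) <= \tr ((X * X^T) ^+ (2 ^ k))) /\
  (forall P Q, P^T = P -> Q^T = Q -> \tr ((P * Q) ^+ (2 ^ k))
     <= (\tr (P ^+ (2 * 2 ^ k)) + \tr (Q ^+ (2 * 2 ^ k))) / 2).
Proof.
elim: k => [|k [IH1 IH2]].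
  split=> [X|P Q Ps Qs]; rewrite !expn0 !muln1 ?expr2 ?expr1.
    by apply: le_trans (mxtrace_mul_le _ _) _; lra.
  by apply: le_trans (mxtrace_mul_le _ _) _; rewrite Ps Qs.
split=> [X|P Q Ps Qs].
  rewrite exprM; apply: le_trans (_ : _ <= \tr ((X ^+ 2 * (X ^+ 2)^T) ^+ (2 ^ k))) _.
    by rewrite expnS; exact: IH1.
  rewrite trmxX expr2 -mulrA mxtrace_exprM.
  have -> : X * (X^T ^+ 2) * X = (X * X^T) * (X^T * X) by rewrite expr2 !mulrA.
  apply: le_trans (IH2 _ _ _ _) _; try by rewrite -mulmxE trmx_mul trmxK.
  by rewrite expnS (mxtrace_exprM X^T); lra.
rewrite expnS; apply: le_trans (IH1 _) _.
have -> : P * Q * (P * Q)^T = P * (Q ^+ 2 * P).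
  by rewrite -mulmxE trmx_mul Ps Qs !mulmxE expr2 !mulrA.
rewrite mxtrace_exprM -mulrA -expr2 mxtrace_exprM.
apply: le_trans (IH2 _ _ _ _) _; try by rewrite trmxX ?Ps ?Qs.
by rewrite -!exprM.
Qed.

(** Halving the exponent squares both factors: with X = AB, the trace of X^(2M) is at most that of
    (X X^T)^M, and X X^T = A B^2 A is cyclically equivalent to A^2 B^2. *)
Lemma mxtrace_mulX_le k A B : A^T = A -> B^T = B ->
  \tr ((A * B) ^+ (2 ^ k)) <= \tr (A ^+ (2 ^ k) * B ^+ (2 ^ k)).
Proof.
elim: k A B => [|k IH] A B As Bs; first by rewrite expn0 !expr1.
rewrite expnS; apply: le_trans ((mxtrace_pow2_le k).1 _) _.
have -> : A * B * (A * B)^T = A * (B ^+ 2 * A).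
  by rewrite -mulmxE trmx_mul As Bs !mulmxE expr2 !mulrA.
rewrite mxtrace_exprM -mulrA -expr2 mxtrace_exprM !exprM.
by apply: IH; rewrite trmxX ?As ?Bs.
Qed.

Lemma op_boundMr A B a b : 0 <= a ->
  op_bound A a -> op_bound B b -> op_bound (A * B) (a * b).
Proof. exact: op_boundM. Qed.

(** Telescoping: each of the [k.+1] terms contains one difference and [k] factors bounded by [a]. *)
Lemma op_boundB_expr A B a d k : 0 <= a -> 0 <= d -> op_bound A a -> op_bound B a ->
  op_bound (A - B) d -> op_bound (A ^+ k.+1 - B ^+ k.+1) (k.+1%:R * d * a ^+ k).
Proof.
move=> a0 d0 Aa Ba ABd; elim: k => [|k IH].
  by rewrite !expr1 expr0 mul1r mulr1.
have -> : A ^+ k.+2 - B ^+ k.+2 = A * (A ^+ k.+1 - B ^+ k.+1) + (A - B) * B ^+ k.+1.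
  by rewrite mulrBr mulrBl -!exprS addrA subrK.
have -> : k.+2%:R * d * a ^+ k.+1 = a * (k.+1%:R * d * a ^+ k) + d * a ^+ k.+1.
  by rewrite exprS -addn1 natrD; ring.
apply: op_boundD; first exact: op_boundMr.
by apply: op_boundMr => //; exact: op_boundX.
Qed.

Lemma mxtrace_op_bound A a : op_bound A a -> `|\tr A| <= m%:R * a.
Proof.
move=> Aa; apply: le_trans (ler_norm_sum _ _ _) _.
have -> : m%:R * a = \sum_(i < m) a by rewrite sumr_const card_ord mulr_natl.
apply: ler_sum => i _.
have e1 : frobenius_norm (delta_mx i 0 : 'cV[R]_m) = 1.
  rewrite /frobenius_norm /inner_mx trmx_delta mul_delta_mx.
  by rewrite /mxtrace big_ord1 mxE !eqxx sqrtr1.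
have -> : A i i = inner_mx (delta_mx i 0) (A *m (delta_mx i 0 : 'cV[R]_m)).
  rewrite inner_mxE (bigD1 i)//= big_ord1 -colE !mxE !eqxx mul1r.
  by rewrite big1 ?addr0// => j ji; rewrite big_ord1 mxE (negbTE ji) mul0r.
have h1 := cauchy_schwarz (delta_mx i 0) (A *m (delta_mx i 0 : 'cV[R]_m)).
have h2 := cauchy_schwarz (- delta_mx i 0) (A *m (delta_mx i 0 : 'cV[R]_m)).
have := Aa (delta_mx i 0); rewrite innerNl froN e1 in h1 h2 *.
by rewrite ler_norml; lra.
Qed.

(* A discrete Golden-Thompson inequality: exp H is replaced by (1 + H/N)^N. *)
Lemma golden_thompson_approx A B a b k (N := (2 ^ k)%N) : A^T = A -> B^T = B ->
  0 <= a -> 0 <= b -> op_bound A a -> op_bound B b ->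
  \tr ((1 + N%:R^-1 *: (A + B)) ^+ N)
  <= \tr ((1 + N%:R^-1 *: A) ^+ N * (1 + N%:R^-1 *: B) ^+ N)
     + m%:R * (a * b * expR (a + b)) / N%:R.
Proof.
move=> As Bs a0 b0 Aa Bb.
have N0 : 0 < N%:R :> R by rewrite ltr0n expn_gt0.
set x := N%:R^-1.
have x0 : 0 < x by rewrite invr_gt0.
have one1 : op_bound (1 : 'M[R]_m) 1 by exact: op_bound1.
have xA : op_bound (x *: A) (x * a) by rewrite -{2}(gtr0_norm x0); exact: op_boundZ.
have xB : op_bound (x *: B) (x * b) by rewrite -{2}(gtr0_norm x0); exact: op_boundZ.
set c := (1 + x * a) * (1 + x * b).
have xa0 : 0 <= x * a by rewrite mulr_ge0 ?(ltW x0).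
have xb0 : 0 <= x * b by rewrite mulr_ge0 ?(ltW x0).
have c0 : 0 <= c by rewrite mulr_ge0 ?addr_ge0.
have cle : c ^+ N <= expR (a + b).
  have e1 y : 0 <= y -> (1 + x * y) ^+ N <= expR y.
    move=> y0; apply: (@le_trans _ _ (expR (x * y) ^+ N)).
      by rewrite lerXn2r ?nnegrE ?expR_ge0 ?addr_ge0 ?mulr_ge0 ?(ltW x0)// ?expR_ge1Dx.
    by rewrite -expRM_natl /x mulrA divff ?mul1r// gt_eqF.
  by rewrite exprMn expRD ler_pM ?exprn_ge0 ?addr_ge0 ?e1.
have bL : op_bound (1 + x *: (A + B)) c.
  apply: (@op_bound_le _ _ _ _ (1 + (x * a + x * b))).
    by rewrite /c; have := mulr_ge0 xa0 xb0; lra.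
  by rewrite scalerDr; apply: op_boundD => //; exact: op_boundD.
have bR : op_bound ((1 + x *: A) * (1 + x *: B)) c.
  by apply: op_boundMr; rewrite ?addr_ge0//; exact: op_boundD.
(* The bases differ only by the second-order product, of size [x * a * (x * b)]. With N telescoping
   terms and x = 1/N this leaves an error of order a b / N. *)
have dLR : op_bound (1 + x *: (A + B) - (1 + x *: A) * (1 + x *: B)) (x * a * (x * b)).
  have -> : 1 + x *: (A + B) - (1 + x *: A) * (1 + x *: B) = - ((x *: A) * (x *: B)).
    rewrite mulrDl mul1r mulrDr mulr1 scalerDr; move: (x *: A * _) => w.
    by apply/matrixP => i j; rewrite !mxE; ring.
  by apply: op_boundN; exact: op_boundMr.
have [K NK] : exists K, N = K.+1 by exists N.-1; rewrite prednK// expn_gt0.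
have d0 : 0 <= x * a * (x * b) by rewrite mulr_ge0.
have := op_boundB_expr K c0 d0 bL bR dLR; rewrite -NK => /mxtrace_op_bound.
rewrite raddfB /= => /ler_normlP[_ h].
have h2 := mxtrace_mulX_le k.
have s1 (M : 'M[R]_m) : M^T = M -> (1 + x *: M)^T = 1 + x *: M.
  by move=> Ms; rewrite linearD /= linearZ /= Ms trmx1.
have {}h2 := h2 _ _ (s1 _ As) (s1 _ Bs).
apply: (le_trans (y := \tr (((1 + x *: A) * (1 + x *: B)) ^+ N)
   + m%:R * (N%:R * (x * a * (x * b)) * c ^+ K))).
  by rewrite -lerBlDl.
apply: lerD; first exact: h2.
rewrite -[leRHS]mulrA ler_wpM2l//.
have -> : N%:R * (x * a * (x * b)) * c ^+ K = x * (a * b) * c ^+ K.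
  by rewrite /x; field; rewrite gt_eqF.
rewrite [leRHS]mulrC -/x -!mulrA ler_wpM2l ?(ltW x0)// !mulrA ler_wpM2l ?mulr_ge0//.
apply: le_trans cle; rewrite NK exprS ler_peMl ?exprn_ge0//.
by rewrite /c; have := mulr_ge0 xa0 xb0; lra.
Qed.

End TracePowers.

(** * Bounded measurable functions and their approximation by simple functions *)

Section BoundedMeasurable.
Context {d} {T : measurableType d} {R : realType}.
Implicit Types f g : T -> R.

(** The bound holds at every point. The class is closed under sums and products, so integrability is
    automatic for every polynomial in the matrix entries. *)
Definition bounded_mfun f : Prop :=
  measurable_fun setT f /\ exists K, forall x, `|f x| <= K.

Lemma bounded_mfun_cst c : bounded_mfun (fun=> c).
Proof. by split; [exact: measurable_cst | exists `|c|]. Qed.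

Lemma bounded_mfunD f g : bounded_mfun f -> bounded_mfun g ->
  bounded_mfun (fun x => f x + g x).
Proof.
move=> [mf [K fK]] [mg [L gL]]; split; first exact: measurable_funD.
by exists (K + L) => x; apply: le_trans (ler_normD _ _) _; exact: lerD.
Qed.

Lemma bounded_mfunM f g : bounded_mfun f -> bounded_mfun g ->
  bounded_mfun (fun x => f x * g x).
Proof.
move=> [mf [K fK]] [mg [L gL]]; split; first exact: measurable_funM.
by exists (K * L) => x; rewrite normrM ler_pM.
Qed.

Lemma bounded_mfunB f g : bounded_mfun f -> bounded_mfun g ->
  bounded_mfun (fun x => f x - g x).
Proof.
move=> bf bg; have := bounded_mfunD bf (bounded_mfunM (bounded_mfun_cst (-1)) bg).
by under eq_fun do rewrite mulN1r.
Qed.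

Lemma bounded_mfun_sum (I : Type) (s : seq I) (F : I -> T -> R) :
  (forall i, bounded_mfun (F i)) -> bounded_mfun (fun x => \sum_(i <- s) F i x).
Proof.
move=> bF; elim: s => [|i s IH].
  by under eq_fun do rewrite big_nil; exact: bounded_mfun_cst.
by under eq_fun do rewrite big_cons; exact: bounded_mfunD.
Qed.

Lemma bounded_mfun_prod (I : Type) (s : seq I) (F : I -> T -> R) :
  (forall i, bounded_mfun (F i)) -> bounded_mfun (fun x => \prod_(i <- s) F i x).
Proof.
move=> bF; elim: s => [|i s IH].
  by under eq_fun do rewrite big_nil; exact: bounded_mfun_cst.
by under eq_fun do rewrite big_cons; exact: bounded_mfunM.
Qed.

Lemma bounded_mfun_indic (A : set T) : measurable A -> bounded_mfun (\1_A).
Proof.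
move=> mA; split; first exact: measurable_indic.
by exists 1 => x; rewrite indicE; case: (_ \in _); rewrite ?normr1 ?normr0.
Qed.

Lemma bounded_mfun_comp d' (S : measurableType d') (c : S -> R) (W : T -> S) :
  measurable_fun setT W -> measurable_fun setT c ->
  (exists K, forall x, `|c x| <= K) -> bounded_mfun (fun w => c (W w)).
Proof.
move=> mW mc [K cK]; split; last by exists K => w; exact: cK.
exact: (measurableT_comp mc mW).
Qed.

(** Layer by layer: subtract [e] on the set where [f] is at least [e]. This lowers the number [J] of
    remaining layers by one. *)
Lemma simple_approximation (e : R) J f : 0 < e -> measurable_fun setT f ->
  (forall x, 0 <= f x <= J%:R * e) ->
  exists B : 'I_J -> set T, (forall j, measurable (B j)) /\
    forall x, let s := \sum_j e * \1_(B j) x in 0 <= s <= f x /\ f x <= s + e.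
Proof.
move=> e0; elim: J f => [|J IH] f mf fJ.
  exists (fun _ => set0); split=> [[] //|x /=]; rewrite big_ord0.
  have := fJ x; rewrite mul0r => /andP[f0 f1]; split; lra.
pose A := f @^-1` [set y | e <= y].
have mA : measurable A.
  rewrite /A -[_ @^-1` _]setTI; apply: mf => //.
  have -> : [set y | e <= y] = `[e, +oo[%classic.
    by apply/seteqP; split=> y /=; rewrite in_itv /= andbT.
  exact: measurable_itv.
pose g x := (f x - e) * \1_A x.
have mg : measurable_fun setT g.
  apply: measurable_funM; last exact: measurable_indic.
  by apply: measurable_funB => //; exact: measurable_cst.
have Ax x : \1_A x = (e <= f x)%R%:R :> R.
  by rewrite indicE; congr (nat_of_bool _)%:R; apply/idP/idP; rewrite inE.
have gJ x : 0 <= g x <= J%:R * e.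
  rewrite /g Ax; have := fJ x; rewrite -addn1 natrD mulrDl mul1r => /andP[f0 f1].
  case: (leP e (f x)) => h; rewrite ?mulr1 ?mulr0; first by apply/andP; split; lra.
  by rewrite lexx mulr_ge0// ltW.
have [B [mB BP]] := IH g mg gJ.
exists (fun j => if unlift ord0 j is Some i then B i else A); split.
  by move=> j; case: unliftP => [i _|_] //.
move=> x /=; rewrite big_ord_recl unlift_none.
under eq_bigr do rewrite liftK.
have /= := BP x; set s := \sum_j _; rewrite /g Ax.
have := fJ x => /andP[f0 f1].
case: (leP e (f x)) => h; rewrite ?mulr1 ?mulr0 => -[/andP[s0 s1] s2].
  by split; [apply/andP; split|]; lra.
by split; [apply/andP; split|]; lra.
Qed.

End BoundedMeasurable.

(** * Expectation of bounded functions *)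

Section Expectation.
Context {d} {T : measurableType d} {R : realType} (P : probability T R).
Implicit Types f g : T -> R.

Definition Ex f : R := \int[P]_w f w.

Lemma bounded_mfun_integrable f : bounded_mfun f -> P.-integrable setT (EFin \o f).
Proof.
move=> [mf [K fK]]; apply: measurable_bounded_integrable => //.
  exact: (eq_ind_r (fun x => (x < +oo)%E) (ltry 1) (probability_setT P)).
exists K; split; first exact: num_real.
by move=> M KM x _; exact: le_trans (fK x) (ltW KM).
Qed.

Lemma ExD f g : bounded_mfun f -> bounded_mfun g ->
  Ex (fun w => f w + g w) = Ex f + Ex g.
Proof. by move=> bf bg; apply: RintegralD => //; exact: bounded_mfun_integrable. Qed.

Lemma ExZ c f : bounded_mfun f -> Ex (fun w => c * f w) = c * Ex f.
Proof. by move=> bf; apply: RintegralZl => //; exact: bounded_mfun_integrable. Qed.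

Lemma ExB f g : bounded_mfun f -> bounded_mfun g ->
  Ex (fun w => f w - g w) = Ex f - Ex g.
Proof. by move=> bf bg; apply: RintegralB => //; exact: bounded_mfun_integrable. Qed.

Lemma Ex_cst c : Ex (fun=> c) = c.
Proof. rewrite /Ex Rintegral_cst//.
by apply: etrans (congr1 (fun x => c * fine x) (probability_setT P)) _; rewrite /= mulr1. Qed.

Lemma Ex_sum (I : Type) (s : seq I) (F : I -> T -> R) :
  (forall i, bounded_mfun (F i)) ->
  Ex (fun w => \sum_(i <- s) F i w) = \sum_(i <- s) Ex (F i).
Proof.
move=> bF; elim: s => [|i s IH].
  by rewrite big_nil -[RHS]Ex_cst; congr Ex; apply/funext => w; rewrite big_nil.
rewrite big_cons -IH -ExD//; last exact: bounded_mfun_sum.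
by congr Ex; apply/funext => w; rewrite big_cons.
Qed.

Lemma Ex_le f g : bounded_mfun f -> bounded_mfun g ->
  (forall w, f w <= g w) -> Ex f <= Ex g.
Proof.
by move=> bf bg fg; apply: le_Rintegral => //; exact: bounded_mfun_integrable.
Qed.

Lemma Ex_norm_le f K : bounded_mfun f -> (forall w, `|f w| <= K) -> `|Ex f| <= K.
Proof.
move=> bf fK; rewrite ler_norml; apply/andP; split.
  rewrite -[leLHS]Ex_cst; apply: Ex_le => //; first exact: bounded_mfun_cst.
  by move=> w; have := fK w; rewrite ler_norml => /andP[].
rewrite -[leRHS]Ex_cst; apply: Ex_le => //; first exact: bounded_mfun_cst.
by move=> w; have := fK w; rewrite ler_norml => /andP[].
Qed.

Lemma Ex_indic (A : set T) : measurable A -> Ex (\1_A) = fine (P A).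
Proof. by move=> mA; rewrite /Ex /Rintegral integral_indic// setIT. Qed.

Lemma markov_inequality f a : bounded_mfun f -> (forall w, 0 <= f w) -> 0 <= a ->
  measurable [set w | a <= f w] /\ a * fine (P [set w | a <= f w]) <= Ex f.
Proof.
move=> bf f0 a0; have mA : measurable [set w | a <= f w].
  have -> : [set w | a <= f w] = f @^-1` `[a, +oo[%classic.
    by apply/seteqP; split=> y /=; rewrite in_itv /= andbT.
  by rewrite -[_ @^-1` _]setTI; apply: bf.1 => //; exact: measurable_itv.
split=> //; rewrite -Ex_indic// -ExZ; last exact: bounded_mfun_indic.
apply: Ex_le => //.
  by apply: bounded_mfunM; [exact: bounded_mfun_cst|exact: bounded_mfun_indic].
move=> w; rewrite indicE; case: (boolP (w \in _)) => [|_]; last by rewrite mulr0.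
by rewrite inE /= mulr1.
Qed.

(** A monotone class argument by uniform approximation: from indicators to simple functions, then to
    nonnegative bounded functions, then to all bounded ones. [H] may have any sign. *)
Lemma Ex_comp_eq0 d' (S : measurableType d') (W : T -> S) (H : T -> R) (c : S -> R) :
  measurable_fun setT W -> bounded_mfun H ->
  (forall B, measurable B -> Ex (fun w => \1_B (W w) * H w) = 0) ->
  bounded_mfun c -> Ex (fun w => c (W w) * H w) = 0.
Proof.
move=> mW bH H0 [mc [K cK]].
have bcomp (g : S -> R) : bounded_mfun g -> bounded_mfun (fun w => g (W w)).
  by move=> [? ?]; exact: bounded_mfun_comp.
have [L' HL'] := bH.2; pose L := `|L'|; have L0 : 0 <= L by exact: normr_ge0.
have HL w : `|H w| <= L by apply: le_trans (HL' w) (ler_norm _).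
have pos (g : S -> R) J (e : R) : 0 < e -> measurable_fun setT g ->
    (forall x, 0 <= g x <= J%:R * e) -> `|Ex (fun w => g (W w) * H w)| <= e * L.
  move=> e0 mg gJ; have [B [mB BP]] := simple_approximation e0 mg gJ.
  pose s x := \sum_j e * \1_(B j) x.
  have bs : bounded_mfun s.
    apply: bounded_mfun_sum => j; apply: bounded_mfunM; first exact: bounded_mfun_cst.
    exact: bounded_mfun_indic.
  have bg : bounded_mfun g.
    by split=> //; exists (J%:R * e) => x; have /andP[? ?] := gJ x; rewrite ger0_norm.
  have sH : Ex (fun w => s (W w) * H w) = 0.
    have -> : (fun w => s (W w) * H w) = (fun w => \sum_j e * (\1_(B j) (W w) * H w)).
      by apply/funext => w; rewrite mulr_suml; apply: eq_bigr => j _; rewrite mulrA.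
    have bj j : bounded_mfun (fun w => \1_(B j) (W w) * H w).
      by apply: bounded_mfunM => //; apply: (bcomp _ (bounded_mfun_indic (mB j))).
    rewrite Ex_sum => [|j].
      by rewrite big1// => j _; rewrite ExZ// H0// mulr0.
    by apply: bounded_mfunM => //; exact: bounded_mfun_cst.
  rewrite -[Ex _]subr0 -sH -ExB; [|by apply: bounded_mfunM => //; exact: bcomp..].
  apply: Ex_norm_le.
    by apply: bounded_mfunB; apply: bounded_mfunM => //; exact: bcomp.
  move=> w; rewrite -mulrBl normrM ler_pM// ger0_norm; have /= [/andP[? ?] ?] := BP (W w); rewrite /s; lra.
have pos0 (g : S -> R) M : measurable_fun setT g -> (forall x, 0 <= g x <= M) ->
    Ex (fun w => g (W w) * H w) = 0.
  move=> mg gM; apply/eqP; rewrite -normr_le0; apply/ler_addgt0Pr => e e0.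
  (* Adding 1 keeps the denominator positive when [L] is 0. *)
  rewrite add0r; pose e' := e / (L + 1).
  have L1 : 0 < L + 1 by rewrite ltr_wpDl.
  have e'0 : 0 < e' by rewrite divr_gt0.
  have [J MJ] : exists J : nat, M <= J%:R * e'.
    exists (Num.bound `|M / e'|); rewrite -ler_pdivrMr//.
    by apply: le_trans (ler_norm _) (ltW (archi_boundP _)).
  apply: (le_trans (pos g J e' e'0 mg _)).
    by move=> x; have /andP[-> h] := gM x; exact: le_trans MJ.
  by rewrite /e' mulrAC ler_pdivrMr// ler_wpM2l// ?lerDl// ltW.
(* Shifting by the bound [K] makes [c] nonnegative; the correction is the constant function 1,
   itself nonnegative. *)
have -> : (fun w => c (W w) * H w) = (fun w => (c (W w) + K) * H w - K * (1 * H w)).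
  by apply/funext => w; ring.
have bK (k : R) := @bounded_mfun_cst _ T R k.
have bc : bounded_mfun (fun w => c (W w)) by apply: bcomp; split=> //; exists K.
rewrite ExB; first last.
- by apply: bounded_mfunM => //; exact: bounded_mfunM.
- by apply: bounded_mfunM => //; exact: bounded_mfunD.
rewrite (pos0 (fun x => c x + K) (K + K)); first last.
- by move=> x; have := cK x; rewrite ler_norml => /andP[? ?]; apply/andP; split; lra.
- by apply: measurable_funD => //; exact: measurable_cst.
rewrite ExZ; last exact: bounded_mfunM.
have -> : Ex (fun w => 1 * H w) = 0.
  by apply: (pos0 (fun=> 1) 1) => [|x]; [exact: measurable_cst|rewrite ler01 lexx].
by rewrite mulr0 subr0.
Qed.

End Expectation.

(** * Independence for products of bounded functions *)

Section Independence.
Context {d} {T : measurableType d} {R : realType} (P : probability T R).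
Context {d'} {S : measurableType d'} {n : nat} (W : 'I_n -> T -> S).
Hypothesis mW : forall i, measurable_fun setT (W i).
Hypothesis indepW : mutually_independent P W.

Lemma bounded_mfun_compW i (c : S -> R) : bounded_mfun c -> bounded_mfun (fun w => c (W i w)).
Proof. by move=> [mc bc]; exact: bounded_mfun_comp. Qed.

Lemma Ex_prod_indic (B : 'I_n -> set S) : (forall i, measurable (B i)) ->
  Ex P (fun w => \prod_i \1_(B i) (W i w)) = \prod_i Ex P (fun w => \1_(B i) (W i w)).
Proof.
move=> mB.
have mWB i : measurable (W i @^-1` B i) by rewrite -[_ @^-1` _]setTI; exact: mW.
have E1 i : Ex P (fun w => \1_(B i) (W i w)) = fine (P (W i @^-1` B i)).
  by rewrite -Ex_indic.
under [RHS]eq_bigr do rewrite E1.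
have mI : measurable (\bigcap_(i in [set` [set: 'I_n]%SET]) (W i @^-1` B i)).
  by apply: fin_bigcap_measurable => //; exact: finite_finset.
transitivity (fine (P (\bigcap_(i in [set` [set: 'I_n]%SET]) (W i @^-1` B i)))).
  rewrite -Ex_indic//; congr Ex; apply/funext => w; rewrite [RHS]indicE.
  case: (boolP (w \in _)) => [|/negP h].
    rewrite inE => h; rewrite big1// => i _; rewrite indicE mem_set//.
    by apply: h => /=; rewrite inE.
  apply/eqP/prodf_eq0.
  have : exists i, ~ B i (W i w).
    apply/existsNP => h'; apply: h; rewrite inE => i _ /=; exact: h'.
  by move=> [i hi]; exists i => //; rewrite indicE memNset.
rewrite (indepW _ mB) (_ : \prod_(i in _) _ = \prod_i P (W i @^-1` B i))%E.
  suff -> : (\prod_i P (W i @^-1` B i))%E = (\prod_i fine (P (W i @^-1` B i)))%:E by [].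
  elim/big_rec2: _ => [//|i x y _ ->].
  by rewrite EFinM fineK ?fin_num_measure.
by apply: eq_bigl => i; rewrite inE.
Qed.

(** Indicators are replaced by bounded functions one coordinate at a time: in [main], the factors of
    index at least [k] are still indicators. At [k] equal to [n] nothing is required of them. *)
Lemma Ex_prod_indep (phi : 'I_n -> S -> R) : (forall i, bounded_mfun (phi i)) ->
  Ex P (fun w => \prod_i phi i (W i w)) = \prod_i Ex P (fun w => phi i (W i w)).
Proof.
have main k : (k <= n)%N -> forall phi : 'I_n -> S -> R,
    (forall i, bounded_mfun (phi i)) ->
    (forall i : 'I_n, (k <= i)%N -> exists2 B, measurable B & phi i = \1_B) ->
  Ex P (fun w => \prod_i phi i (W i w)) = \prod_i Ex P (fun w => phi i (W i w)).
  elim: k => [_|k IH kn] {}phi bphi iphi.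
    have /choice[B hB] : forall i, exists B, measurable B /\ phi i = \1_B.
      by move=> i; have [B ? ?] := iphi i isT; exists B.
    have -> : phi = fun i => \1_(B i) by apply/funext => i; exact: (hB i).2.
    by apply: Ex_prod_indic => i; exact: (hB i).1.
  pose kk := Ordinal kn.
  pose G w := \prod_(i | i != kk) phi i (W i w).
  pose g := \prod_(i | i != kk) Ex P (fun w => phi i (W i w)).
  have bG : bounded_mfun G.
    rewrite /G; under eq_fun do rewrite big_mkcond.
    apply: (@bounded_mfun_prod _ _ _ _ _ (fun i w => if i != kk then phi i (W i w) else 1)) => i.
    case: (i != kk) => /=; last exact: bounded_mfun_cst.
    exact: bounded_mfun_compW.
  (* Centering the other factors turns factorization into the vanishing of an expectation, which is
     linear in the factor at [kk] and extends from indicators. *)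
  pose H w := G w - g.
  have bH : bounded_mfun H by apply: bounded_mfunB => //; exact: bounded_mfun_cst.
  have EH (c : S -> R) : bounded_mfun c -> Ex P (fun w => c (W kk w) * H w) =
      Ex P (fun w => c (W kk w) * G w) - Ex P (fun w => c (W kk w)) * g.
    move=> bc; have bcW := bounded_mfun_compW kk bc.
    rewrite [_ * g]mulrC -ExZ// -ExB; last 2 first.
    - exact: bounded_mfunM.
    - by apply: bounded_mfunM => //; exact: bounded_mfun_cst.
    by congr Ex; apply/funext => w; rewrite /H; ring.
  have H0 B : measurable B -> Ex P (fun w => \1_B (W kk w) * H w) = 0.
    move=> mB; rewrite EH; last exact: bounded_mfun_indic.
    pose psi i := if i == kk then \1_B else phi i.
    have -> : (fun w => \1_B (W kk w) * G w) = (fun w => \prod_i psi i (W i w)).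
      apply/funext => w; rewrite (bigD1 kk)//= /psi eqxx; congr (_ * _).
      by apply: eq_bigr => i /negbTE ->.
    rewrite (IH (ltnW kn) psi); last 2 first.
    - move=> i; rewrite /psi; case: ifP => // _; exact: bounded_mfun_indic.
    - move=> i ki; rewrite /psi; case: eqP => [_|/eqP ik]; first by exists B.
      by apply: iphi; rewrite ltn_neqAle ki andbT; apply: contra ik => /eqP e; apply/eqP/val_inj.
    rewrite (bigD1 kk)//= /psi eqxx /g.
    under eq_bigr => i /negbTE h do rewrite h.
    by rewrite subrr.
  have := Ex_comp_eq0 (mW kk) bH H0 (bphi kk).
  rewrite EH// => /eqP; rewrite subr_eq0 => /eqP h.
  rewrite [RHS](bigD1 kk)//= -/g -h; congr Ex; apply/funext => w.
  by rewrite (bigD1 kk).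
by move=> bphi; apply: (main n) => // i; rewrite leqNgt ltn_ord.
Qed.

(* The algebra generated by the bounded functions of W 0, ..., W (k - 1). *)
Inductive past (k : nat) : (T -> R) -> Prop :=
| past_mon c (phi : 'I_n -> S -> R) :
    (forall i, bounded_mfun (phi i)) ->
    (forall i : 'I_n, (k <= i)%N -> phi i = fun=> 1) ->
    past k (fun w => c * \prod_i phi i (W i w))
| past_add f g : past k f -> past k g -> past k (fun w => f w + g w).

Lemma past_bounded k f : past k f -> bounded_mfun f.
Proof.
elim=> [c phi bphi _|{}f g _ bf _ bg]; last exact: bounded_mfunD.
apply: bounded_mfunM; first exact: bounded_mfun_cst.
by apply: bounded_mfun_prod => i; exact: bounded_mfun_compW.
Qed.

Lemma past_mul k f g : past k f -> past k g -> past k (fun w => f w * g w).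
Proof.
move=> pf pg; elim: pf => [c phi bphi h|f1 f2 _ p1 _ p2]; last first.
  by under eq_fun do rewrite mulrDl; exact: past_add.
elim: pg => [c' psi bpsi h'|f1 f2 _ p1 _ p2]; last first.
  by under eq_fun do rewrite mulrDr; exact: past_add.
have -> : (fun w => c * \prod_i phi i (W i w) * (c' * \prod_i psi i (W i w)))
    = (fun w => c * c' * \prod_i (fun x => phi i x * psi i x) (W i w)).
  by apply/funext => w; rewrite big_split /=; ring.
apply: (past_mon _ (phi := fun i x => phi i x * psi i x)) => [i|i ki].
  exact: bounded_mfunM.
by rewrite h// h'//; apply/funext => x; rewrite mulr1.
Qed.

Lemma past_cst k c : past k (fun=> c).
Proof.
have -> : (fun=> c) = fun w : T => c * \prod_(i < n) (fun=> 1 : R) (W i w).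
  by apply/funext => w; rewrite big1 ?mulr1.
by apply: (past_mon _ (phi := fun _ _ => 1)) => // i; exact: bounded_mfun_cst.
Qed.

Lemma past_comp k (i : 'I_n) (c : S -> R) : (i < k)%N -> bounded_mfun c ->
  past k (fun w => c (W i w)).
Proof.
move=> ik bc; pose phi j := if j == i then c else fun=> 1.
have -> : (fun w => c (W i w)) = fun w => 1 * \prod_j phi j (W j w).
  apply/funext => w; rewrite mul1r (bigD1 i)//= /phi eqxx big1 ?mulr1// => j.
  by move=> /negbTE ->.
apply: past_mon => [j|j kj]; rewrite /phi.
  by case: ifP => _ //; exact: bounded_mfun_cst.
by case: eqP => // ji; rewrite ji leqNgt ik in kj.
Qed.

Lemma past_sum k (I : Type) (s : seq I) (F : I -> T -> R) :
  (forall i, past k (F i)) -> past k (fun w => \sum_(i <- s) F i w).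
Proof.
move=> pF; elim: s => [|i s IH].
  by under eq_fun do rewrite big_nil; exact: past_cst.
by under eq_fun do rewrite big_cons; exact: past_add.
Qed.

(** In a monomial of the past the factor at [k] is the constant 1, so [c] can take its place and the
    product formula applies. *)
Lemma Ex_past_mul (k : 'I_n) f (c : S -> R) : past k f -> bounded_mfun c ->
  Ex P (fun w => f w * c (W k w)) = Ex P f * Ex P (fun w => c (W k w)).
Proof.
move=> pf bc; have bcW := bounded_mfun_compW k bc.
elim: pf => [a phi bphi h|f1 f2 p1 e1 p2 e2]; last first.
  under eq_fun do rewrite mulrDl.
  have b1 := past_bounded p1; have b2 := past_bounded p2.
  by rewrite !ExD ?e1 ?e2 ?mulrDl//; exact: bounded_mfunM.
have bprod (psi : 'I_n -> S -> R) : (forall i, bounded_mfun (psi i)) ->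
    bounded_mfun (fun w => \prod_i psi i (W i w)).
  by move=> bpsi; apply: bounded_mfun_prod => i; exact: bounded_mfun_compW.
pose psi i := if i == k then c else phi i.
have bpsi i : bounded_mfun (psi i) by rewrite /psi; case: ifP.
have -> : (fun w => a * \prod_i phi i (W i w) * c (W k w))
    = fun w => a * \prod_i psi i (W i w).
  apply/funext => w; rewrite -mulrA (bigD1 k)//= [in RHS](bigD1 k)//= /psi eqxx h//.
  rewrite [in RHS](eq_bigr (fun i => phi i (W i w))) => [|i /negbTE ->//]; ring.
rewrite !ExZ ?Ex_prod_indep//; try exact: bprod.
rewrite -mulrA (bigD1 k)//= [in RHS](bigD1 k)//= /psi eqxx h// Ex_cst.
rewrite [in LHS](eq_bigr (fun i => Ex P (fun w => phi i (W i w)))) => [|i /negbTE ->//]; ring.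
Qed.

End Independence.

(** * Powers of perturbations of the identity *)

Section MatrixPowers.
Variable R : realType.
Variable m : nat.

(** The remainder is kept between two copies of [Z], so that its quadratic form is controlled by |Z
    u|^2, the source of the variance. [r] obeys the same recursion with [Z] replaced by 1, hence is
    read off from the scalar power. *)
Lemma expr_expand (Z : 'M[R]_m) (x : R) k : 0 < x -> op_bound Z 1 ->
  exists (B : 'M[R]_m) (r : R),
    [/\ 0 <= r, op_bound B r, (1 + x) ^+ k = 1 + k%:R * x + x ^+ 2 * r &
        (1 + x *: Z) ^+ k = 1 + (k%:R * x) *: Z + x ^+ 2 *: (Z * B * Z)].
Proof.
move=> x0 Z1; elim: k => [|k [B [r [r0 Br e1 e2]]]].
  exists 0, 0; split => //; first by move=> u; rewrite mul0mx fro0 mul0r.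
    by rewrite expr0; ring.
  by rewrite expr0 mul0r scale0r !mulr0 mul0r scaler0 !addr0.
have one1 : op_bound (1 : 'M[R]_m) 1 by exact: op_bound1.
have key (A : 'M[R]_m) : A * (1 + x *: Z) = A + x *: (A *m Z).
  by rewrite mulrDr mulr1 -mulmxE scalemxAr.
have xZ : op_bound (1 + x *: Z) (1 + x).
  by apply: op_boundD => //; rewrite -{2}[x]mulr1 -{2}(gtr0_norm x0); exact: op_boundZ.
(* Multiplying the expansion by [1 + x *: Z] creates the new term k Z^2 and changes Z B Z into Z B
   (1 + x Z) Z, as [Z] commutes with [1 + x *: Z]. *)
exists (k%:R *: 1%:M + B * (1 + x *: Z)), (k%:R + r * (1 + x)); split.
- by rewrite addr_ge0// mulr_ge0// addr_ge0// ltW.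
- apply: op_boundD; last exact: op_boundMr.
  by rewrite -[X in op_bound _ X]mulr1 -{2}(ger0_norm (ler0n R k)); exact: op_boundZ.
- by rewrite exprSr e1 -[k.+1]addn1 natrD; ring.
- rewrite exprSr e2 !key -!mulmxE !mulmxDl !mulmxDr !mulmxDl.
  rewrite -!scalemxAr -!scalemxAl mulmx1 !mulmxA.
  have -> : 1 *m Z = Z by exact: mul1mx.
  set U := Z *m Z; set V := Z *m B *m Z; set T := V *m Z.
  by apply/matrixP => a c; rewrite -[k.+1]addn1 natrD !mxE; ring.
Qed.

(** The value 3 makes the scalar remainder (1 + 1/N)^N - 2 at most 1. It follows from e^(-1/6) >=
    5/6, since (5/6)^6 >= 1/3. *)
Lemma expR1_le3 : expR 1 <= 3 :> R.
Proof.
have h : 5 / 6 <= expR (- (1 / 6)) :> R by apply: le_trans (expR_ge1Dx _); lra.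
have p0 : 0 < expR (- (1 / 6)) :> R by exact: expR_gt0.
have : expR (- (1 / 6)) ^+ 6 * expR 1 = 1 :> R.
  by rewrite -expRM_natl -expRD (_ : _ + 1 = 0) ?expR0//; field.
have h6 : (5 / 6) ^+ 6 <= expR (- (1 / 6)) ^+ 6 :> R.
  by rewrite lerXn2r ?nnegrE ?(ltW p0)// divr_ge0.
have e0 : 0 < expR 1 :> R by exact: expR_gt0.
have h7 : 1 / 3 <= (5 / 6) ^+ 6 :> R by rewrite expr_div_n; lra.
move=> e1; rewrite -(ler_pM2l (_ : 0 < 1 / 3 :> R))//.
have := ler_wpM2r (ltW e0) (le_trans h7 h6); rewrite e1; lra.
Qed.

Lemma pow_le_expR (x : R) N : (0 < N)%N -> 0 <= x ->
  (1 + x / N%:R) ^+ N <= expR x.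
Proof.
move=> N0 x0; have n0 : N%:R != 0 :> R by rewrite pnatr_eq0 -lt0n.
apply: (@le_trans _ _ (expR (x / N%:R) ^+ N)).
  rewrite lerXn2r ?nnegrE ?expR_ge0 ?expR_ge1Dx//.
  by rewrite addr_ge0// divr_ge0.
by rewrite -expRM_natl mulrCA divff// mulr1.
Qed.

(** The counterpart of exp Z <= 1 + Z + Z^2 in the Loewner order, for symmetric [Z] of norm at most
    1. *)
Lemma quad_expr_le (Z : 'M[R]_m) N (u : 'cV[R]_m) : (0 < N)%N ->
  Z^T = Z -> op_bound Z 1 ->
  inner_mx u ((1 + N%:R^-1 *: Z) ^+ N *m u) <=
  frobenius_norm u ^+ 2 + inner_mx u (Z *m u) + frobenius_norm (Z *m u) ^+ 2.
Proof.
move=> N0 Zs Z1; have n0 : N%:R != 0 :> R by rewrite pnatr_eq0 -lt0n.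
have x0 : 0 < N%:R^-1 :> R by rewrite invr_gt0 ltr0n.
have [B [r [r0 Br e1 ->]]] := expr_expand N x0 Z1.
rewrite divff// scale1r in e1 *.
have xr : N%:R^-1 ^+ 2 * r <= 1.
  have := pow_le_expR N0 (ler01 : 0 <= 1 :> R); rewrite mul1r e1.
  by have := expR1_le3; lra.
rewrite -!mulmxE !mulmxDl -scalemxAl !innerDr innerZr sqr_fro.
rewrite [1 *m u]mul1mx lerD2l.
have -> : inner_mx u (Z *m B *m Z *m u) = inner_mx (Z *m u) (B *m (Z *m u)).
  by rewrite inner_mull Zs !mulmxA.
have q0 : 0 <= frobenius_norm (Z *m u) ^+ 2 by exact: sqr_ge0.
have h : inner_mx (Z *m u) (B *m (Z *m u)) <= r * frobenius_norm (Z *m u) ^+ 2.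
  apply: le_trans (cauchy_schwarz _ _) _.
  by rewrite expr2 mulrCA ler_wpM2l ?fro_ge0.
apply: (@le_trans _ _ (N%:R^-1 ^+ 2 * (r * frobenius_norm (Z *m u) ^+ 2))).
  by rewrite ler_wpM2l ?sqr_ge0.
by rewrite mulrA -[leRHS]mul1r ler_wpM2r.
Qed.

Lemma tr_diag_conj (Q : 'M[R]_m) (d : 'rV[R]_m) x k : Q *m Q^T = 1%:M ->
  (1 + x *: (Q^T *m diag_mx d *m Q)) ^+ k
  = Q^T *m diag_mx (\row_i (1 + x * d 0 i) ^+ k) *m Q.
Proof.
move=> QQ; have QQ' := mulmx1C QQ.
have E1 : 1 + x *: (Q^T *m diag_mx d *m Q) = Q^T *m diag_mx (\row_i (1 + x * d 0 i)) *m Q.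
  rewrite -[1]/(1%:M) -QQ' scalemxAl scalemxAr -mulmxDl -{1}[Q^T]mulmx1 -mulmxDr.
  congr (_ *m _ *m _); apply/matrixP => i j; rewrite !mxE.
  by case: eqVneq => _; rewrite ?mulr1n ?mulr0n ?mulr0 ?addr0.
elim: k => [|k IH].
  rewrite expr0 -[1]/(1%:M) -QQ' -{1}[Q^T]mulmx1; congr (_ *m _ *m _).
  by apply/matrixP => i j; rewrite !mxE; case: eqVneq => _; rewrite ?expr0.
rewrite exprS IH E1 -mulmxE !mulmxA -(mulmxA _ Q) QQ mulmx1 -(mulmxA Q^T) mulmx_diag.
congr (_ *m diag_mx _ *m _); apply/rowP => i; by rewrite !mxE exprS.
Qed.

(* N is even, so every term of the trace is nonnegative and none of them can
   reach the bound alone. *)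
Lemma quad_of_trace (M : 'M[R]_m) s l (N := (2 ^ l.+1)%N) : M^T = M -> 0 <= s ->
  \tr ((1 + N%:R^-1 *: M) ^+ N) < (1 + s / N%:R) ^+ N ->
  forall u : 'cV_m, inner_mx u (M *m u) <= s * frobenius_norm u ^+ 2.
Proof.
move=> Ms s0; have [Q [d [QQ ME]]] := spectral_symmetric Ms.
have QQ' := mulmx1C QQ.
have N0 : 0 < N%:R :> R by rewrite ltr0n expn_gt0.
have evenN y : 0 <= y ^+ N :> R by rewrite /N expnS exprM exprn_ge0// sqr_ge0.
have trE (e : 'rV[R]_m) : \tr (Q^T *m diag_mx e *m Q) = \sum_i e 0 i.
  by rewrite mxtrace_mulC mulmxA QQ mul1mx mxtrace_diag.
rewrite ME tr_diag_conj// trE => h.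
have ds i : d 0 i <= s.
  rewrite leNgt; apply/negP => sd; move: h; apply/negP; rewrite -leNgt.
  rewrite (bigD1 i)//= mxE -[leLHS]addr0; apply: lerD.
    rewrite lerXn2r ?nnegrE ?addr_ge0 ?mulr_ge0 ?invr_ge0 ?(ltW N0)//.
      exact: le_trans (ltW sd).
    by rewrite lerD2l [leRHS]mulrC ler_wpM2r ?invr_ge0 ?(ltW N0)// ltW.
  by apply: sumr_ge0 => j _; rewrite mxE evenN.
move=> u; set v := Q *m u.
have -> : inner_mx u (Q^T *m diag_mx d *m Q *m u) = \sum_i d 0 i * v i 0 ^+ 2.
  have -> : inner_mx u (Q^T *m diag_mx d *m Q *m u) = inner_mx v (diag_mx d *m v).
    by rewrite /v inner_mull !mulmxA.
  rewrite inner_mxE mul_diag_mx; apply: eq_bigr => i _.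
  by rewrite big_ord1 !mxE; ring.
have -> : frobenius_norm u ^+ 2 = \sum_i v i 0 ^+ 2.
  rewrite sqr_fro.
  have -> : inner_mx u u = inner_mx v v by rewrite /v inner_mull mulmxA QQ' mul1mx.
  by rewrite inner_mxE; apply: eq_bigr => i _; rewrite big_ord1 expr2.
by rewrite mulr_sumr; apply: ler_sum => i _; rewrite ler_wpM2r ?sqr_ge0.
Qed.

(** By symmetry of [C] the trace is the sum of the quadratic forms of [b] at the columns of [C], so
    a bound on the form passes to the trace. *)
Lemma mxtrace_sqr_le (C b : 'M[R]_m) t : C^T = C ->
  (forall u : 'cV_m, inner_mx u (b *m u) <= t * frobenius_norm u ^+ 2) ->
  \tr (C ^+ 2 * b) <= t * \tr (C ^+ 2).
Proof.
move=> Cs bt.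
have -> : \tr (C ^+ 2 * b) = \sum_j inner_mx (col j C) (b *m col j C).
  rewrite expr2 -!mulmxE -mulmxA mxtrace_mulC -{1}Cs -mulmxA.
  rewrite /mxtrace; apply: eq_bigr => j _.
  rewrite inner_mxE mxE; apply: eq_bigr => i _.
  have -> : b *m col j C = col j (b *m C) by rewrite !colE mulmxA.
  by rewrite big_ord1 !mxE.
have -> : \tr (C ^+ 2) = \sum_j frobenius_norm (col j C) ^+ 2.
  by rewrite -sqr_fro_col sqr_fro /inner_mx Cs mulmxE expr2.
by rewrite mulr_sumr; apply: ler_sum.
Qed.

(** Stated for any class closed under the ring operations, to serve both [past] and
    [bounded_mfun]. *)
Lemma entries_expr (T : Type) (F : (T -> R) -> Prop)
    (Fc : forall c, F (fun=> c))
    (FD : forall f g, F f -> F g -> F (fun w => f w + g w))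
    (FM : forall f g, F f -> F g -> F (fun w => f w * g w))
    (A : T -> 'M[R]_m) x N :
  (forall i j, F (fun w => A w i j)) ->
  forall i j, F (fun w => ((1 + x *: A w) ^+ N) i j).
Proof.
move=> FA; elim: N => [|N IH] i j.
  by under eq_fun do rewrite expr0; exact: Fc.
under eq_fun do rewrite exprS -mulmxE mxE.
elim: (index_enum _) => [|k s IHs].
  by under eq_fun do rewrite big_nil; exact: Fc.
under eq_fun do rewrite big_cons.
apply: (FD (fun w => (1 + x *: A w) i k * ((1 + x *: A w) ^+ N) k j)) => //.
apply: (FM (fun w => (1 + x *: A w) i k)) => //.
under eq_fun do rewrite !mxE; apply: (FD (fun=> _)) => //.
by apply: (FM (fun=> x)).
Qed.

End MatrixPowers.

Lemma bounded_sqr_fro_mul d (T : measurableType d) (R : realType) p q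
    (F : T -> 'M[R]_(p, q)) (u : 'cV[R]_q) :
  (forall i j, bounded_mfun (fun w => F w i j)) ->
  bounded_mfun (fun w => frobenius_norm (F w *m u) ^+ 2).
Proof.
move=> bF; under eq_fun do rewrite sqr_fro inner_mxE.
apply: bounded_mfun_sum => i; apply: bounded_mfun_sum => j.
suff b1 : bounded_mfun (fun w => (F w *m u) i j) by exact: bounded_mfunM.
under eq_fun do rewrite mxE.
apply: bounded_mfun_sum => k; apply: bounded_mfunM => //; exact: bounded_mfun_cst.
Qed.

(** * Matrix Bernstein inequality for symmetric summands *)

Section MatrixBernstein.
Context {d} {T : measurableType d} {R : realType} (P : probability T R).
Context {d'} {S : measurableType d'} {n : nat} (W : 'I_n -> T -> S).
Hypothesis mW : forall i, measurable_fun setT (W i).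
Hypothesis indepW : mutually_independent P W.
Variables (m : nat) (Z : 'I_n -> S -> 'M[R]_m) (tau : R).
Hypothesis Zsym : forall i x, (Z i x)^T = Z i x.
Hypothesis Zbounded : forall i a b, bounded_mfun (fun x => Z i x a b).
Hypothesis Zle1 : forall i x, op_bound (Z i x) 1.
Hypothesis Zcentered : forall i a b, Ex P (fun w => Z i (W i w) a b) = 0.
Hypothesis tau_ge0 : 0 <= tau.
Hypothesis Zvariance : forall i (u : 'cV[R]_m),
  Ex P (fun w => frobenius_norm (Z i (W i w) *m u) ^+ 2) <= tau * frobenius_norm u ^+ 2.

Definition partial_sum k w : 'M[R]_m := \sum_(i < n | (i < k)%N) Z i (W i w).

Lemma partial_sum0 w : partial_sum 0 w = 0.
Proof. by rewrite /partial_sum big_pred0. Qed.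

Lemma partial_sumS (k : 'I_n) w :
  partial_sum k.+1 w = partial_sum k w + Z k (W k w).
Proof.
rewrite /partial_sum (bigD1 k)//= addrC; congr (_ + _); apply: eq_bigl => i.
by rewrite ltnS [RHS]ltn_neqAle andbC.
Qed.

Lemma partial_sum_sym k w : (partial_sum k w)^T = partial_sum k w.
Proof. by rewrite /partial_sum raddf_sum; apply: eq_bigr => i _; exact: Zsym. Qed.

Lemma partial_sum_bound k w : (k <= n)%N -> op_bound (partial_sum k w) k%:R.
Proof.
elim: k => [_|k IH kn].
  by rewrite partial_sum0 => u; rewrite mul0mx fro0 mul0r.
rewrite (partial_sumS (Ordinal kn)) -addn1 natrD; apply: op_boundD => //.
exact: IH (ltnW kn).
Qed.

Lemma partial_sum_past k i j : past W k (fun w => partial_sum k w i j).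
Proof.
have -> : (fun w => partial_sum k w i j)
    = fun w => \sum_(l < n) (if (l < k)%N then Z l (W l w) i j else 0).
  apply/funext => w; rewrite /partial_sum summxE big_mkcond /=.
  by apply: eq_bigr => l _; case: ifP.
apply: (past_sum _ (F := fun (l : 'I_n) w => if (l < k)%N then Z l (W l w) i j else 0)) => l.
case: ltnP => lk; last exact: past_cst.
by apply: (past_comp W (c := fun x => Z l x i j)).
Qed.

Lemma past_exprE k x N i j :
  past W k (fun w => ((1 + x *: partial_sum k w) ^+ N) i j).
Proof.
apply: entries_expr => [c|f g|f g|{}i {}j].
- exact: past_cst.
- exact: past_add.
- exact: past_mul.
- exact: partial_sum_past.
Qed.

Lemma bounded_exprE l x N i j :
  bounded_mfun (fun y => ((1 + x *: Z l y) ^+ N) i j).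
Proof.
apply: entries_expr => [c|f g|f g|{}i {}j].
- exact: bounded_mfun_cst.
- exact: bounded_mfunD.
- exact: bounded_mfunM.
- exact: Zbounded.
Qed.

(** Stands in for the trace moment generating function E tr exp S_k; its scale parameter is absorbed
    in [Z]. *)
Definition mgf (N : nat) k : R := Ex P (fun w => \tr ((1 + N%:R^-1 *: partial_sum k w) ^+ N)).

Lemma bounded_trace N k :
  bounded_mfun (fun w => \tr ((1 + N%:R^-1 *: partial_sum k w) ^+ N)).
Proof.
apply: bounded_mfun_sum => i.
exact: (past_bounded mW (past_exprE _ _ _ _ _)).
Qed.

(* The conditional expectation of (1 + Z/N)^N given the past is bounded by
   1 + tau in the Loewner order; the last term is the Golden-Thompson error. *)
Lemma mgf_step l (k : 'I_n) (N := (2 ^ l.+1)%N) :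
  mgf N k.+1 <= (1 + tau) * mgf N k + m%:R * (n%:R * expR (n%:R + 1)) / N%:R.
Proof.
have N0 : (0 < N)%N by rewrite expn_gt0.
have kn : (k <= n)%N by exact: ltnW.
set x := N%:R^-1.
pose A w := (1 + x *: partial_sum k w) ^+ N.
pose B y := (1 + x *: Z k y) ^+ N.
pose b : 'M[R]_m := \matrix_(i, j) Ex P (fun w => B (W k w) i j).
have bA i j : bounded_mfun (fun w => A w i j) by exact: (past_bounded mW (past_exprE _ _ _ _ _)).
have bB i j : bounded_mfun (fun w => B (W k w) i j).
  by apply: (bounded_mfun_compW mW k (c := fun y => B y i j)); exact: bounded_exprE.
have bcst c : bounded_mfun (fun _ : T => c) by exact: bounded_mfun_cst.
have bAB i j : bounded_mfun (fun w => A w i j * B (W k w) j i) by exact: bounded_mfunM.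
have bAb i j : bounded_mfun (fun w => A w i j * b j i) by exact: bounded_mfunM.
have trE (M M' : 'M[R]_m) : \tr (M * M') = \sum_i \sum_j M i j * M' j i.
  by rewrite /mxtrace; apply: eq_bigr => i _; rewrite -mulmxE mxE.
have btr (F : T -> 'M[R]_m) : (forall i j, bounded_mfun (fun w => A w i j * F w j i)) ->
    bounded_mfun (fun w => \tr (A w * F w)).
  move=> bF; under eq_fun do rewrite trE.
  by apply: bounded_mfun_sum => i; apply: bounded_mfun_sum => j.
(* Entrywise, [A] belongs to the past and [B] is a function of the new variable, so [B] may be
   replaced by its mean [b]. *)
have EAB : Ex P (fun w => \tr (A w * B (W k w))) = Ex P (fun w => \tr (A w * b)).
  under [in LHS]eq_fun do rewrite trE.
  under [in RHS]eq_fun do rewrite trE.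
  rewrite !Ex_sum => [|i|i]; [|exact: bounded_mfun_sum..].
  apply: eq_bigr => i _; rewrite !Ex_sum => [|//|//]; apply: eq_bigr => j _.
  rewrite (Ex_past_mul mW indepW (c := fun y => B y j i)); last 2 first.
  - exact: past_exprE.
  - exact: bounded_exprE.
  under [in RHS]eq_fun do rewrite mulrC.
  by rewrite ExZ// mulrC !mxE.
have bquad (u : 'cV[R]_m) : inner_mx u (b *m u) <= (1 + tau) * frobenius_norm u ^+ 2.
  have iE (M : 'M[R]_m) : inner_mx u (M *m u) = \sum_i \sum_j u i 0 * (u j 0 * M i j).
    rewrite inner_mxE; apply: eq_bigr => i _; rewrite big_ord1 mxE mulr_sumr.
    by apply: eq_bigr => j _; ring.
  have bq (F : T -> 'M[R]_m) : (forall i j, bounded_mfun (fun w => F w i j)) ->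
      bounded_mfun (fun w => inner_mx u (F w *m u)) /\
      Ex P (fun w => inner_mx u (F w *m u))
       = \sum_i \sum_j u i 0 * (u j 0 * Ex P (fun w => F w i j)).
    move=> bF.
    have b1 i j : bounded_mfun (fun w => u j 0 * F w i j) by exact: bounded_mfunM.
    have b2 i j : bounded_mfun (fun w => u i 0 * (u j 0 * F w i j)) by exact: bounded_mfunM.
    under eq_fun do rewrite iE.
    split; first by apply: bounded_mfun_sum => i; exact: bounded_mfun_sum.
    rewrite Ex_sum => [|i]; last exact: bounded_mfun_sum.
    apply: eq_bigr => i _; rewrite Ex_sum//; apply: eq_bigr => j _.
    by rewrite !ExZ.
  have [bB1 EB1] := bq (fun w => B (W k w)) bB.
  have bZ i j : bounded_mfun (fun w => Z k (W k w) i j).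
    by apply: (bounded_mfun_compW mW k (c := fun y => Z k y i j)).
  have [bZ1 EZ1] := bq (fun w => Z k (W k w)) bZ.
  have bZ2 := bounded_sqr_fro_mul u bZ.
  have -> : inner_mx u (b *m u) = Ex P (fun w => inner_mx u (B (W k w) *m u)).
    rewrite EB1 iE; apply: eq_bigr => i _; apply: eq_bigr => j _.
    by rewrite mxE.
  apply: (@le_trans _ _ (Ex P (fun w => (frobenius_norm u ^+ 2 + inner_mx u (Z k (W k w) *m u)) +
     frobenius_norm (Z k (W k w) *m u) ^+ 2))).
    apply: Ex_le => //; first by do 2?apply: bounded_mfunD.
    by move=> w; exact: quad_expr_le.
  rewrite !ExD//; last exact: bounded_mfunD.
  rewrite Ex_cst EZ1 big1 => [|i _]; last first.
    by rewrite big1// => j _; rewrite Zcentered !mulr0.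
  by rewrite addr0 mulrDl mul1r lerD2l.
have step w : \tr ((1 + x *: partial_sum k.+1 w) ^+ N) <=
    \tr (A w * B (W k w)) + m%:R * (n%:R * expR (n%:R + 1)) / N%:R.
  rewrite partial_sumS.
  have kle : op_bound (partial_sum k w) n%:R.
    by apply: op_bound_le (partial_sum_bound w kn); rewrite ler_nat.
  have := golden_thompson_approx l.+1 (partial_sum_sym k w) (Zsym k (W k w))
    (ler0n R n) ler01 kle (@Zle1 k (W k w)).
  by rewrite mulr1.
apply: (@le_trans _ _ (Ex P (fun w => \tr (A w * B (W k w)) +
    m%:R * (n%:R * expR (n%:R + 1)) / N%:R))).
  apply: Ex_le => //; first exact: bounded_trace.
  by apply: bounded_mfunD => //; apply: btr.
rewrite ExD ?Ex_cst//; last by apply: btr.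
rewrite lerD2r EAB -ExZ; last exact: bounded_trace.
apply: Ex_le; [exact: btr|by apply: bounded_mfunM => //; exact: bounded_trace|].
move=> w; rewrite -/(A w).
(* As N is even, [A w] is the square of a symmetric matrix, the form in which the bound on [b] can
   be used. *)
have -> : A w = ((1 + x *: partial_sum k w) ^+ (2 ^ l)) ^+ 2.
  by rewrite -exprM mulnC -expnS.
apply: mxtrace_sqr_le => //.
by rewrite trmxX linearD /= linearZ /= partial_sum_sym trmx1.
Qed.

Lemma mgf_le l (N := (2 ^ l.+1)%N) :
  mgf N n <= (1 + tau) ^+ n * (m%:R + n%:R * (m%:R * (n%:R * expR (n%:R + 1)) / N%:R)).
Proof.
set C := m%:R * _ / _.
have C0 : 0 <= C.
  by rewrite divr_ge0// mulr_ge0// mulr_ge0// expR_ge0.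
suff main k : (k <= n)%N -> mgf N k <= (1 + tau) ^+ k * (m%:R + k%:R * C) by exact: main.
elim: k => [_|k IH kn].
  rewrite /mgf; under eq_fun do rewrite partial_sum0 scaler0 addr0 expr1n.
  by rewrite Ex_cst mxtrace1 expr0 mul1r mul0r addr0.
have := mgf_step l (Ordinal kn); rewrite -/N -/C /= => h; apply: le_trans h _.
have t1 : 0 <= 1 + tau by rewrite addr_ge0.
apply: (@le_trans _ _ ((1 + tau) * ((1 + tau) ^+ k * (m%:R + k%:R * C)) + C)).
  by rewrite lerD2r ler_wpM2l// IH// ltnW.
have -> : k.+1%:R = k%:R + 1 :> R by rewrite -[k.+1]addn1 natrD.
rewrite mulrA -exprS mulrDl mul1r addrA [leRHS]mulrDr lerD2l.
rewrite -[leLHS]mul1r ler_wpM2r//; apply: exprn_ege1; rewrite lerDl//.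
Qed.

(** The limit is made effective by (1 + s/N)^N >= e^s (1 - s^2/N), and N is then taken larger than
    [C / e]. *)
Lemma expR_limit_le (p K D s : R) : 0 <= p -> 0 <= s ->
  (forall l, p * (1 + s / (2 ^ l.+1)%:R) ^+ (2 ^ l.+1) <= K + D / (2 ^ l.+1)%:R) ->
  p * expR s <= K.
Proof.
move=> p0 s0 h; apply/ler_addgt0Pr => e e0.
pose C := p * expR s * s ^+ 2 + `|D|.
have C0 : 0 <= C by rewrite addr_ge0// mulr_ge0 ?sqr_ge0// mulr_ge0// expR_ge0.
pose l := Num.bound (C / e); pose N := (2 ^ l.+1)%N.
have N0 : 0 < N%:R :> R by rewrite ltr0n expn_gt0.
have CN : C / N%:R <= e.
  rewrite ler_pdivrMr// mulrC -ler_pdivrMr//.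
  apply: (@le_trans _ _ l%:R); first by apply/ltW/archi_boundP; rewrite divr_ge0// ltW.
  by rewrite ler_nat /N; apply: (@leq_trans l.+1) => //; exact: ltnW (ltn_expl _ _).
set y := s / N%:R; have y0 : 0 <= y by rewrite divr_ge0// ltW.
have y1 : 0 < 1 + y by rewrite ltr_wpDr.
have low : expR s * (1 - s ^+ 2 / N%:R) <= (1 + y) ^+ N.
  (* With z = y/(1+y) one has (1 - z)(1 + y) = 1, so 1 - z <= e^(-z) inverts to this upper bound. *)
  have h1 : expR (y / (1 + y)) <= 1 + y.
    have h2 : 1 - y / (1 + y) <= expR (- (y / (1 + y))) by exact: expR_ge1Dx.
    rewrite -(ler_pM2l (expR_gt0 (- (y / (1 + y))))) -expRD addNr expR0.
    apply: le_trans (_ : (1 - y / (1 + y)) * (1 + y) <= _); last by rewrite ler_pM2r.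
    by rewrite mulrBl mul1r divfK ?gt_eqF//; lra.
  apply: (@le_trans _ _ (expR (y / (1 + y)) ^+ N)); last first.
    by rewrite lerXn2r ?nnegrE ?expR_ge0// ltW.
  rewrite -expRM_natl.
  have h3 : s - s ^+ 2 / N%:R <= N%:R * (y / (1 + y)).
    have -> : N%:R * (y / (1 + y)) = s / (1 + y) by rewrite mulrA /y mulrCA divff ?mulr1 ?gt_eqF.
    rewrite ler_pdivlMr// (_ : s ^+ 2 / N%:R = s * y); last by rewrite /y; ring.
    have : 0 <= s * y ^+ 2 by rewrite mulr_ge0// sqr_ge0.
    by nra.
  apply: (@le_trans _ _ (expR (s - s ^+ 2 / N%:R))); last by rewrite ler_expR.
  by rewrite expRD ler_wpM2l ?expR_ge0// expR_ge1Dx.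
have := h l; rewrite -/N -/y => hl.
have := ler_wpM2l p0 low => hlow.
have D1 : D / N%:R <= `|D| / N%:R by rewrite ler_wpM2r ?invr_ge0 ?(ltW N0)// ler_norm.
have CE : C / N%:R = p * (expR s * (s ^+ 2 / N%:R)) + `|D| / N%:R by rewrite /C; ring.
by move: CN; rewrite CE; move: hl hlow D1; rewrite mulrBr mulr1 mulrBr; lra.
Qed.

(** Markov's inequality at level (1 + s/N)^N for each N, followed by the limit. Quantifying over
    measurable subsets [F] of the bad event avoids discussing that event's own measurability. *)
Theorem matrix_bernstein (s : R) (F : set T) : 0 <= s -> measurable F ->
  (forall w, F w ->
     ~ forall u : 'cV_m, inner_mx u (partial_sum n w *m u) <= s * frobenius_norm u ^+ 2) ->
  fine (P F) * expR s <= (1 + tau) ^+ n * m%:R.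
Proof.
move=> s0 mF hF.
apply: (@expR_limit_le _ _ ((1 + tau) ^+ n * (n%:R * (m%:R * (n%:R * expR (n%:R + 1)))))) => //.
  by rewrite fine_ge0.
move=> l; set N := (2 ^ l.+1)%N.
pose f w := \tr ((1 + N%:R^-1 *: partial_sum n w) ^+ N).
have f0 w : 0 <= f w.
  rewrite /f /N expnSr exprM expr2.
  set C := _ ^+ (2 ^ l); have Cs : C^T = C.
    by rewrite /C trmxX linearD /= linearZ /= partial_sum_sym trmx1.
  by have := inner_ge0 C; rewrite /inner_mx Cs.
have a0 : 0 <= (1 + s / N%:R) ^+ N by rewrite exprn_ge0// addr_ge0// divr_ge0.
have [mB hB] := markov_inequality P (bounded_trace N n) f0 a0.
have FB : F `<=` [set w | (1 + s / N%:R) ^+ N <= f w].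
  move=> w /hF nq /=; rewrite leNgt; apply/negP => lt; apply: nq.
  exact: (quad_of_trace (partial_sum_sym n w) s0 lt).
have PFB : fine (P F) <= fine (P [set w | (1 + s / N%:R) ^+ N <= f w]).
  by apply: fine_le; rewrite ?fin_num_measure// le_measure// inE.
apply: (le_trans (ler_wpM2r a0 PFB)); rewrite mulrC; apply: (le_trans hB).
apply: (le_trans (mgf_le l)); rewrite -/N mulrDr lerD2l.
by rewrite !mulrA.
Qed.

End MatrixBernstein.

(** * Measurability of sets determined by a random matrix *)

Section Measurability.
Context {R : realType} {m1 m2 : nat}.

Lemma measurable_coord (j : 'I_m1) (k : 'I_m2) :
  measurable_fun setT (fun x : borel_mx R m1 m2 => (x : 'M[R]_(m1, m2)) j k).
Proof.
move=> mT; apply: (measurability _ (RGenOInfty.measurableE R)) => // _ [_ [x ->] <-].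
rewrite setTI; apply: sub_sigma_algebra.
have /continuousP := @coord_continuous R m1 m2 j k; apply.
exact: interval_open.
Qed.

Lemma measurable_mx1 (E : 'M[R]_(m1, m2)) : measurable ([set E] : set (borel_mx R m1 m2)).
Proof.
have -> : [set E] = \bigcap_(p in [set` [set: 'I_m1 * 'I_m2]%SET])
    ((fun x : borel_mx R m1 m2 => (x : 'M[R]_(m1, m2)) p.1 p.2) @^-1` [set E p.1 p.2]).
  apply/seteqP; split=> [x -> p _ //|x h]; apply/matrixP => i j.
  by apply: (h (i, j)) => /=; rewrite inE.
apply: fin_bigcap_measurable => [|p _]; first exact: finite_finset.
by rewrite -[_ @^-1` _]setTI; apply: measurable_coord => //; exact: measurable_set1.
Qed.

Context {d} {T : measurableType d}.

Lemma fro_le_entries (A : 'M[R]_(m1, m2)) e : 0 <= e ->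
  (forall i j, `|A i j| <= e) -> frobenius_norm A <= (m1 * m2)%:R * e.
Proof.
move=> e0 Ae; have mm0 : 0 <= (m1 * m2)%:R * e :> R by rewrite mulr_ge0.
rewrite -(ler_pXn2r (n := 2)) ?nnegrE ?fro_ge0// sqr_fro inner_mxE.
apply: (@le_trans _ _ (\sum_(i < m1) \sum_(j < m2) e ^+ 2)).
  apply: ler_sum => i _; apply: ler_sum => j _.
  by rewrite -expr2 -(ger0_norm (sqr_ge0 (A i j))) normrX lerXn2r ?nnegrE.
under eq_bigr do rewrite sumr_const card_ord.
rewrite sumr_const card_ord -mulrnA mulnC -[leLHS]mulr_natl exprMn ler_wpM2r ?sqr_ge0//.
by rewrite -natrX ler_nat -mulnn; case: (m1 * m2)%N => // q; rewrite leq_pmulr.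
Qed.

Lemma rational_approx (A : 'M[R]_(m1, m2)) e : 0 < e ->
  exists q : 'M[rat]_(m1, m2), forall i j, `|A i j - ratr (q i j)| <= e.
Proof.
move=> e0.
have : forall p : 'I_m1 * 'I_m2, exists q : rat, `|A p.1 p.2 - ratr q| <= e.
  move=> [i j] /=; have [|q] := @rat_in_itvoo R (A i j - e) (A i j + e); first lra.
  rewrite in_itv /= => /andP[h1 h2]; exists q.
  by rewrite ler_norml; apply/andP; split; lra.
move=> /choice[f fP]; exists (\matrix_(i, j) f (i, j)) => i j.
by rewrite mxE; exact: (fP (i, j)).
Qed.

(** The hypothesis says that [E] is the preimage under [G] of the closure of [G(E)]. Rational
    matrices near both [G w] and some point of [G(E)] express this by countable unions and
    intersections. *)
Lemma measurable_of_approx (G : T -> 'M[R]_(m1, m2)) (E : set T) :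
  (forall i j, measurable_fun setT (fun w => G w i j)) ->
  (forall w, (forall e, 0 < e -> exists2 w', E w' & frobenius_norm (G w - G w') <= e) -> E w) ->
  measurable E.
Proof.
move=> mG closedE.
pose near (e : R) (w : T) (q : 'M[rat]_(m1, m2)) := forall i j, `|G w i j - ratr (q i j)| <= e.
have near_mble e q : measurable [set w | near e w q].
  have -> : [set w | near e w q] = \bigcap_(p in [set` [set: 'I_m1 * 'I_m2]%SET])
     [set w | `|G w p.1 p.2 - ratr (q p.1 p.2)| <= e].
    apply/seteqP; split=> [w h p _|w h i j]; first exact: h.
    by apply: (h (i, j)) => /=; rewrite inE.
  apply: fin_bigcap_measurable => [|p _]; first exact: finite_finset.
  rewrite -[X in measurable X]setTI; apply: measurable_fun_le => //.
  apply: measurableT_comp => //; apply: measurable_funB => //; exact: measurable_cst.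
pose N := (fun k : nat => k.+1%:R^-1 : R).
have N0 k : 0 < N k by rewrite invr_gt0.
have -> : E = \bigcap_k \bigcup_(q : 'M[rat]_(m1, m2))
    ([set w | near (N k) w q] `&` [set w | exists2 w', E w' & near (N k) w' q]).
  apply/seteqP; split=> [w Ew k _|w h].
    have [q qP] := rational_approx (G w) (N0 k).
    by exists q => //; split=> //; exists w.
  apply: closedE => e e0.
  (* Two grid errors per entry, times the factor [m1 * m2] from entries to the Frobenius norm; the 1
     ensures positivity. *)
  pose C : R := (m1 * m2)%:R * 2 + 1.
  have C0 : 0 < C by rewrite ltr_wpDl// mulr_ge0.
  pose k := Num.bound (C / e).
  have Nk : C * N k <= e.
    rewrite /N ler_pdivrMr// mulrC -ler_pdivrMr//.
    apply: (@le_trans _ _ k%:R); last by rewrite ler_nat.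
    by apply/ltW/archi_boundP; rewrite divr_ge0// ltW.
  have [q _ [wq [w' Ew' w'q]]] := h k I.
  exists w' => //.
  apply: le_trans (fro_le_entries (e := 2 * N k) _ _) _.
  - by rewrite mulr_ge0// ltW.
  - move=> i j; rewrite !mxE.
    have := wq i j; have := w'q i j; rewrite !ler_norml => /andP[h1 h2] /andP[h3 h4].
    by apply/andP; split; lra.
  - by apply: le_trans Nk; have := N0 k; rewrite /C; lra.
apply: bigcapT_measurable => k.
apply: countable_bigcupT_measurable => // q; apply: measurableI => //.
(* The condition on [w'] does not involve [w], so the set is everything or empty. *)
have [ex|nex] := pselect (exists2 w', E w' & near (N k) w' q).
  by rewrite (_ : [set _ | _] = setT)//; apply/seteqP; split.
by rewrite (_ : [set _ | _] = set0)//; apply/seteqP; split.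
Qed.

End Measurability.

Lemma fro_label_le (R : realType) p q (c eta : R) (b : 'I_p -> 'I_q -> bool) :
  `|c| <= eta -> (forall j k j' k', b j k -> b j' k' -> j = j' /\ k = k') ->
  frobenius_norm (\matrix_(j, k) (c * (b j k)%:R)) <= eta.
Proof.
move=> ce b_excl; have eta0 : 0 <= eta by exact: le_trans ce.
rewrite -(ler_pXn2r (n := 2)) ?nnegrE ?fro_ge0// sqr_fro inner_mxE.
have [[j [k bjk]]|nb] := pselect (exists j k, b j k).
  rewrite (bigD1 j)//= (bigD1 k)//= big1 => [|k' kk']; last first.
    rewrite mxE; case: (boolP (b j k')) => [h|_]; last by rewrite mulr0 mul0r.
    by have [_ e] := b_excl _ _ _ _ h bjk; rewrite e eqxx in kk'.
  rewrite big1 => [|j' jj']; last first.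
    apply: big1 => k' _; rewrite mxE; case: (boolP (b j' k')) => [h|_]; last by rewrite mulr0 mul0r.
    by have [e _] := b_excl _ _ _ _ h bjk; rewrite e eqxx in jj'.
  rewrite !addr0 mxE bjk mulr1 -expr2.
  by rewrite -(ger0_norm (sqr_ge0 c)) normrX lerXn2r ?nnegrE.
rewrite big1 ?sqr_ge0// => j _; rewrite big1// => k _; rewrite mxE.
by case: (boolP (b j k)) => [h|_]; [case: nb; exists j, k|rewrite mulr0 mul0r].
Qed.

(** * Moments of a random matrix with at most one nonzero entry *)

Section LabelledMatrix.
Context {d} {T : measurableType d} {R : realType} (P : probability T R).
Variables (p q : nat) (c : T -> R) (b : 'I_p -> 'I_q -> T -> bool) (eta mu : R).
Hypothesis eta_ge0 : 0 <= eta.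
Hypothesis bc : bounded_mfun c.
Hypothesis c_le : forall w, `|c w| <= eta.
Hypothesis bb : forall j k, bounded_mfun (fun w => (b j k w)%:R : R).
Hypothesis b_excl : forall w j k j' k', b j k w -> b j' k' w -> j = j' /\ k = k'.
Hypothesis b_prob : forall j k, Ex P (fun w => (b j k w)%:R) = mu.

Let V w : 'M[R]_(p, q) := \matrix_(j, k) (c w * (b j k w)%:R).
Let a : 'M[R]_(p, q) := \matrix_(j, k) Ex P (fun w => c w * (b j k w)%:R).

Lemma Ex_sqr_center (f : T -> R) : bounded_mfun f ->
  Ex P (fun w => (f w - Ex P f) ^+ 2) <= Ex P (fun w => f w ^+ 2).
Proof.
move=> bf; set e := Ex P f.
have be (k : R) : bounded_mfun (fun _ : T => k) by exact: bounded_mfun_cst.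
have -> : (fun w => (f w - e) ^+ 2) = fun w => (f w ^+ 2 - (2 * e) * f w) + e ^+ 2.
  by apply/funext => w; ring.
have b2 : bounded_mfun (fun w => f w ^+ 2) by exact: bounded_mfunM.
have b3 : bounded_mfun (fun w => 2 * e * f w) by exact: bounded_mfunM.
rewrite ExD//; last exact: bounded_mfunB.
rewrite ExB// ExZ// Ex_cst -/e; have := sqr_ge0 e; lra.
Qed.

(** At most one term of the row is nonzero, so the square of the sum is the sum of the squares. *)
Lemma sqr_label_sum w (j : 'I_p) (x : 'I_q -> R) :
  (\sum_k c w * (b j k w)%:R * x k) ^+ 2 <= eta ^+ 2 * \sum_k (b j k w)%:R * x k ^+ 2.
Proof.
have c2 : c w ^+ 2 <= eta ^+ 2.
  by rewrite -(ger0_norm (sqr_ge0 (c w))) normrX lerXn2r ?nnegrE.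
have [[k0 bk0]|nb] := pselect (exists k, b j k w).
  have b0 k : k != k0 -> b j k w = false.
    move=> kk0; apply/negP => bk; have [_ e] := b_excl bk bk0.
    by rewrite e eqxx in kk0.
  rewrite (bigD1 k0)//= big1 => [|k kk0]; last by rewrite b0// mulr0 mul0r.
  rewrite [X in _ <= _ * X](bigD1 k0)//= [X in _ <= _ * (_ + X)]big1 => [|k kk0]; last by rewrite b0// mul0r.
  rewrite bk0 !addr0 mulr1 mul1r exprMn.
  by rewrite ler_wpM2r ?sqr_ge0.
have b0 k : b j k w = false by apply/negP => bk; apply: nb; exists k.
rewrite big1 => [|k _]; last by rewrite b0 mulr0 mul0r.
by rewrite big1 => [|k _]; [rewrite expr0n mulr0|rewrite b0 mul0r].
Qed.

(** Centering only decreases second moments. Each of the [p] rows then contributes at most eta^2 *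
    mu * |u|^2; for mu = 1/(pq) the total factor is eta^2 / q. *)
Lemma labelled_variance (u : 'cV[R]_q) :
  Ex P (fun w => frobenius_norm ((V w - a) *m u) ^+ 2)
  <= eta ^+ 2 * (p%:R * mu) * frobenius_norm u ^+ 2.
Proof.
pose f j w := \sum_k c w * (b j k w)%:R * u k 0.
have bu (k : R) : bounded_mfun (fun _ : T => k) by exact: bounded_mfun_cst.
have bcb j k : bounded_mfun (fun w => c w * (b j k w)%:R) by exact: bounded_mfunM.
have bf j : bounded_mfun (f j).
  by apply: bounded_mfun_sum => k; exact: bounded_mfunM.
have Ef j : Ex P (f j) = \sum_k a j k * u k 0.
  rewrite Ex_sum => [|k]; last exact: bounded_mfunM.
  apply: eq_bigr => k _; under eq_fun do rewrite mulrC.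
  by rewrite ExZ// mulrC mxE.
have nE w : frobenius_norm ((V w - a) *m u) ^+ 2 = \sum_j (f j w - Ex P (f j)) ^+ 2.
  rewrite sqr_fro inner_mxE; apply: eq_bigr => j _; rewrite big_ord1 -expr2; congr (_ ^+ 2).
  rewrite mulmxBl [LHS]mxE [X in _ + X]mxE Ef; congr (_ - _); rewrite mxE //.
  by apply: eq_bigr => k _; rewrite mxE.
under eq_fun do rewrite nE.
have bf2 j : bounded_mfun (fun w => (f j w - Ex P (f j)) ^+ 2).
  by apply: bounded_mfunM; exact: bounded_mfunB.
rewrite Ex_sum//.
have -> : eta ^+ 2 * (p%:R * mu) * frobenius_norm u ^+ 2 = \sum_(j < p) eta ^+ 2 * (mu * frobenius_norm u ^+ 2).
  by rewrite sumr_const card_ord -mulr_natl; ring.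
apply: ler_sum => j _; apply: le_trans (Ex_sqr_center (bf j)) _.
have bg k : bounded_mfun (fun w => (b j k w)%:R * u k 0 ^+ 2) by exact: bounded_mfunM.
apply: (@le_trans _ _ (Ex P (fun w => eta ^+ 2 * \sum_k (b j k w)%:R * u k 0 ^+ 2))).
  apply: Ex_le; first exact: bounded_mfunM.
    by apply: bounded_mfunM => //; exact: bounded_mfun_sum.
  by move=> w; exact: sqr_label_sum.
rewrite ExZ; last exact: bounded_mfun_sum.
rewrite Ex_sum// ler_wpM2l ?sqr_ge0// sqr_fro inner_mxE mulr_sumr.
apply: ler_sum => k _; rewrite big_ord1.
under eq_fun do rewrite mulrC.
by rewrite ExZ// b_prob mulrC expr2.
Qed.

Lemma fro_label_mean : (p * q)%:R * mu = 1 -> mu <= 1 -> frobenius_norm a <= eta.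
Proof.
move=> pqmu mu1; rewrite -(ler_pXn2r (n := 2)) ?nnegrE ?fro_ge0//.
have pq0 : 0 < (p * q)%:R :> R.
  rewrite lt_def ler0n andbT; apply/eqP => h; move: pqmu.
  by rewrite h mul0r => /eqP; rewrite eq_sym oner_eq0.
have mu0 : 0 <= mu by rewrite -(pmulr_rge0 mu pq0) pqmu.
have a_le j k : `|a j k| <= eta * mu.
  have bcb : bounded_mfun (fun w => c w * (b j k w)%:R) by exact: bounded_mfunM.
  have beb (x : R) : bounded_mfun (fun w => x * (b j k w)%:R).
    by apply: bounded_mfunM => //; exact: bounded_mfun_cst.
  rewrite mxE ler_norml -(b_prob j k) -mulNr -!ExZ//; apply/andP; split; apply: Ex_le => //.
    move=> w0; rewrite ler_wpM2r//.
    by have := c_le w0; rewrite ler_norml => /andP[].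
  move=> w0; rewrite ler_wpM2r//.
  by have := c_le w0; rewrite ler_norml => /andP[].
rewrite sqr_fro inner_mxE.
apply: (@le_trans _ _ (\sum_(j < p) \sum_(k < q) (eta * mu) ^+ 2)).
  apply: ler_sum => j _; apply: ler_sum => k _; rewrite -expr2.
  by rewrite -(ger0_norm (sqr_ge0 (a j k))) normrX lerXn2r ?nnegrE ?mulr_ge0.
under eq_bigr do rewrite sumr_const card_ord.
rewrite sumr_const card_ord -mulrnA mulnC -[leLHS]mulr_natl.
have -> : (p * q)%:R * (eta * mu) ^+ 2 = eta ^+ 2 * (mu * ((p * q)%:R * mu)) by ring.
by rewrite pqmu mulr1 -[leRHS]mulr1 ler_wpM2l ?sqr_ge0.
Qed.

End LabelledMatrix.

(** * Self-adjoint dilations of rectangular matrices *)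

Section Dilation.
Variable R : realType.
Variables p q : nat.
Implicit Types D : 'M[R]_(p, q).

Definition dilation D : 'M[R]_(p + q) := block_mx 0 D D^T 0.

Lemma dilation_sym D : (dilation D)^T = dilation D.
Proof. by rewrite /dilation tr_block_mx trmxK !trmx0. Qed.

Lemma dilation_sum (I : Type) (r : seq I) (Q : pred I) (F : I -> 'M[R]_(p, q)) :
  dilation (\sum_(i <- r | Q i) F i) = \sum_(i <- r | Q i) dilation (F i).
Proof.
elim/big_rec2: _ => [|i x y _ <-].
  by rewrite /dilation trmx0 block_mx0.
by rewrite /dilation linearD add_block_mx !addr0.
Qed.

Lemma dilationZ c D : dilation (c *: D) = c *: dilation D.
Proof. by rewrite /dilation linearZ scale_block_mx !scaler0. Qed.

Lemma dilation_mul D (x : 'cV[R]_p) (y : 'cV[R]_q) :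
  dilation D *m col_mx x y = col_mx (D *m y) (D^T *m x).
Proof. by rewrite /dilation mul_block_col !mul0mx add0r addr0. Qed.

Lemma inner_col_mx (x x' : 'cV[R]_p) (y y' : 'cV[R]_q) :
  inner_mx (col_mx x y) (col_mx x' y') = inner_mx x x' + inner_mx y y'.
Proof. by rewrite /inner_mx tr_col_mx mul_row_col linearD. Qed.

Lemma sqr_fro_dilation_mul D (u : 'cV[R]_(p + q)) :
  frobenius_norm (dilation D *m u) ^+ 2
  = frobenius_norm (D *m dsubmx u) ^+ 2 + frobenius_norm (D^T *m usubmx u) ^+ 2.
Proof. by rewrite -{1}[u]vsubmxK dilation_mul !sqr_fro inner_col_mx. Qed.

Lemma sqr_fro_vsubmx (u : 'cV[R]_(p + q)) :
  frobenius_norm u ^+ 2 = frobenius_norm (usubmx u) ^+ 2 + frobenius_norm (dsubmx u) ^+ 2.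
Proof. by rewrite -{1}[u]vsubmxK !sqr_fro inner_col_mx. Qed.

Lemma op_bound_dilation D K : 0 <= K -> op_bound D K -> op_bound (dilation D) K.
Proof.
move=> K0 DK u; rewrite -(ler_pXn2r (n := 2)) ?nnegrE ?mulr_ge0 ?fro_ge0//.
rewrite sqr_fro_dilation_mul exprMn sqr_fro_vsubmx mulrDr addrC; apply: lerD.
  rewrite -exprMn lerXn2r ?nnegrE ?mulr_ge0 ?fro_ge0//; exact: op_bound_tr.
by rewrite -exprMn lerXn2r ?nnegrE ?mulr_ge0 ?fro_ge0.
Qed.

(** A one-sided bound on the quadratic form suffices: the form at (x, y) is 2 <x, D y>, and x may be
    chosen along [D *m y]. *)
Lemma op_bound_of_dilation D K :
  (forall u : 'cV[R]_(p + q), inner_mx u (dilation D *m u) <= K * frobenius_norm u ^+ 2) ->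
  op_bound D K.
Proof.
move=> h y; have [v0|v0] := eqVneq (frobenius_norm (D *m y)) 0.
  rewrite v0; have := h (col_mx 0 y).
  rewrite dilation_mul inner_col_mx inner0l mulmx0 inner0r addr0.
  rewrite sqr_fro inner_col_mx inner0l add0r -sqr_fro expr2 mulrA => h'.
  have [->|y0] := eqVneq (frobenius_norm y) 0; first by rewrite mulr0.
  by rewrite -(pmulr_lge0 _ (_ : 0 < frobenius_norm y))// lt_def y0 fro_ge0.
have vgt0 : 0 < frobenius_norm (D *m y) by rewrite lt_def v0 fro_ge0.
have [y0|y0] := eqVneq (frobenius_norm y) 0.
  have yy : y = 0 by apply: inner_eq0; rewrite -sqr_fro y0 expr0n.
  by rewrite yy mulmx0 !fro0 mulr0.
have ygt0 : 0 < frobenius_norm y by rewrite lt_def y0 fro_ge0.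
(* This scaling gives both halves of the test vector the length |y|, which loses nothing in the
   bound. *)
set c := frobenius_norm y / frobenius_norm (D *m y).
have c0 : 0 < c by rewrite divr_gt0.
have := h (col_mx (c *: (D *m y)) y).
rewrite dilation_mul inner_col_mx sqr_fro inner_col_mx.
rewrite -(inner_mull D).
rewrite !innerZl !innerZr -!sqr_fro.
have cv : c * frobenius_norm (D *m y) = frobenius_norm y by rewrite divfK.
have -> : c * frobenius_norm (D *m y) ^+ 2 = frobenius_norm y * frobenius_norm (D *m y).
  by rewrite expr2 mulrA cv.
rewrite mulrA [c * frobenius_norm y * _]mulrAC cv => h'.
rewrite -(ler_pM2l ygt0); move: h'; lra.
Qed.

End Dilation.

(** * Distribution and moments of a single observation *)

Section OnePair.
Context {d} {T : measurableType d} {R : realType} (P : probability T R).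
Context {m1 m2 : nat}.
Variables (X : {RV P >-> borel_mx R m1 m2}) (Y : {RV P >-> R}).
Variables (A0 : 'M[R]_(m1, m2)) (eta : R).
Hypothesis unifX : uniform_on_canonical_basis X.
Hypothesis condY : is_cond_expectation P Y X
  (fun x : borel_mx R m1 m2 => \tr ((x : 'M[R]_(m1, m2))^T *m A0)).
Hypothesis Y_le : {ae P, forall w, `|Y w| <= eta}.

Lemma uniform_prob (B : set (borel_mx R m1 m2)) : measurable B ->
  P (X @^-1` B) = (\sum_(j < m1) \sum_(k < m2)
    (m1 * m2)%:R^-1 * ((delta_mx j k : borel_mx R m1 m2) \in B)%:R)%:E.
Proof.
move=> mB; have := unifX mB; rewrite /distribution /pushforward /= => ->.
rewrite -sumEFin; apply: eq_bigr => j _; rewrite -sumEFin; apply: eq_bigr => k _.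
by rewrite diracE trmx_delta mul_delta_mx EFinM.
Qed.

Lemma delta_mx_inj (j j' : 'I_m1) (k k' : 'I_m2) :
  delta_mx j k = delta_mx j' k' :> 'M[R]_(m1, m2) -> j = j' /\ k = k'.
Proof.
move/matrixP/(_ j k); rewrite !mxE !eqxx /=.
case: eqP => [->|_]; case: eqP => [->|_] //= /eqP; by rewrite oner_eq0.
Qed.

Lemma prob_basis j k :
  P (X @^-1` [set (delta_mx j k : 'M[R]_(m1, m2))]) = ((m1 * m2)%:R^-1)%:E.
Proof.
rewrite uniform_prob; last exact: measurable_mx1.
rewrite (bigD1 j)//= (bigD1 k)//= mem_set// mulr1.
rewrite !big1 ?addr0// => [j' jj'|k' kk'].
  apply: big1 => k' _; rewrite memNset ?mulr0// => /delta_mx_inj[e _].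
  by rewrite e eqxx in jj'.
rewrite memNset ?mulr0// => /delta_mx_inj[_ e].
by rewrite e eqxx in kk'.
Qed.

Lemma ae_basis : {ae P, forall w, exists j k, X w = (delta_mx j k : 'M[R]_(m1, m2))}.
Proof.
pose B : set (borel_mx R m1 m2) := \bigcap_(p in [set` [set: 'I_m1 * 'I_m2]%SET])
  ~` [set (delta_mx p.1 p.2 : 'M[R]_(m1, m2))].
have mB : measurable B.
  apply: fin_bigcap_measurable => [|p _]; first exact: finite_finset.
  by apply: measurableC; exact: measurable_mx1.
exists (X @^-1` B); split.
- by rewrite -[_ @^-1` _]setTI; exact: measurable_funPT.
- rewrite uniform_prob// big1// => j _; rewrite big1// => k _.
  by rewrite memNset ?mulr0// => h; apply: (h (j, k)) => //=; rewrite inE.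
- move=> w /= nex p _ /= e; apply: nex; exists p.1, p.2; exact: e.
Qed.

(* Y is bounded by eta only almost surely, truncate eta Y everywhere. *)
Definition truncate (y : R) : R := y * \1_(`[- eta, eta]%classic) y.

Lemma truncate_le y : 0 <= eta -> `|truncate y| <= eta.
Proof.
move=> eta0; rewrite /truncate indicE; case: (boolP (y \in _)).
  by rewrite inE /= in_itv /= mulr1 ler_norml.
by rewrite mulr0 normr0.
Qed.

Lemma truncate_id y : `|y| <= eta -> truncate y = y.
Proof.
move=> ye; rewrite /truncate indicE mem_set ?mulr1//= in_itv /=.
by rewrite -ler_norml.
Qed.

Lemma measurable_truncate : measurable_fun setT truncate.
Proof. by apply: measurable_funM => //; apply: measurable_indic; exact: measurable_itv. Qed.

Definition label (j : 'I_m1) (k : 'I_m2) w : bool := (X w : 'M[R]_(m1, m2)) == delta_mx j k.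

Lemma label_indic j k : (fun w => (label j k w)%:R : R) = \1_(X @^-1` [set (delta_mx j k : 'M[R]_(m1, m2))]).
Proof.
apply/funext => w; rewrite indicE /label; congr (nat_of_bool _)%:R.
by apply/eqP/idP => [h|]; rewrite inE.
Qed.

Lemma measurable_label j k : measurable (X @^-1` [set (delta_mx j k : 'M[R]_(m1, m2))]).
Proof. by rewrite -[_ @^-1` _]setTI; apply: measurable_funPT => //; exact: measurable_mx1. Qed.

Lemma Ex_label j k : Ex P (fun w => (label j k w)%:R) = (m1 * m2)%:R^-1.
Proof. by rewrite label_indic Ex_indic ?prob_basis//; exact: measurable_label. Qed.

(** The conditional expectation is evaluated on the atom where [X] is a given basis matrix; there
    the regression function is the constant [A0 j k]. Truncation changes [Y] only on a null set. *)
Lemma Ex_truncate_label j k :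
  Ex P (fun w => truncate (Y w) * (label j k w)%:R) = (m1 * m2)%:R^-1 * A0 j k.
Proof.
pose D := X @^-1` [set (delta_mx j k : 'M[R]_(m1, m2))].
have mD : measurable D by exact: measurable_label.
have mY : measurable_fun setT Y by exact: measurable_funPT.
have [_ _ _ /(_ _ (measurable_mx1 (delta_mx j k)))] := condY.
rewrite -/D => h.
have h2 : (\int[P]_(w in D) (\tr ((X w : 'M[R]_(m1, m2))^T *m A0))%:E = (A0 j k)%:E * P D)%E.
  rewrite -integral_cst//; apply: eq_integral => w; rewrite inE => -> /=.
  rewrite -[\tr _]/(inner_mx (delta_mx j k) A0) inner_mxE (bigD1 j)//= (bigD1 k)//=.
  rewrite mxE !eqxx mul1r !big1 ?addr0// => [j' jj'|k' kk'].
    by apply: big1 => k' _; rewrite mxE (negbTE jj') mul0r.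
  by rewrite mxE (negbTE kk') andbF mul0r.
rewrite h2 prob_basis integral_mkcond in h.
rewrite /Ex /Rintegral.
transitivity (fine (\int[P]_w (((fun w => (Y w)%:E) \_ D) w))%E); last first.
  by rewrite h -EFinM /= mulrC.
congr fine; apply: ae_eq_integral => //.
- apply/measurable_EFinP; apply: measurable_funM.
    exact: (measurableT_comp measurable_truncate mY).
  by rewrite label_indic; exact: measurable_indic.
- apply/(measurable_restrictT _ mD); apply: measurable_funTS; exact/measurable_EFinP.
- case: Y_le => B [mB PB sB]; exists B; split=> // w /= nw; apply: sB => /= Yw.
  apply: nw => _; rewrite truncate_id// patchE /label.
  case: (boolP (w \in D)) => [|/negP]; rewrite inE /D /=.
    by move=> ->; rewrite eqxx mulr1.
  by move=> n; case: eqP => // _; rewrite mulr0.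
Qed.

End OnePair.

(** * Deviation of the noise matrix *)

Section Deviation.
Context {d} {T : measurableType d} {R : realType} (P : probability T R).
Context {m1 m2 n : nat}.
Variables (X : 'I_n -> {RV P >-> borel_mx R m1 m2}) (Y : 'I_n -> {RV P >-> R}).
Variables (A0 : 'M[R]_(m1, m2)) (eta t lambda : R).
Hypothesis m1_gt0 : (0 < m1)%N.
Hypothesis m2_gt0 : (0 < m2)%N.
Hypothesis n_gt0 : (0 < n)%N.
Hypothesis indepXY : mutually_independent P (fun i w => (X i w, Y i w)).
Hypothesis unifX : forall i, uniform_on_canonical_basis (X i).
Hypothesis condY : forall i, is_cond_expectation P (Y i) (X i)
  (fun x : borel_mx R m1 m2 => \tr ((x : 'M[R]_(m1, m2))^T *m A0)).
Hypothesis Y_le : {ae P, forall w, forall i, `|Y i w| <= eta}.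
Hypothesis t_gt0 : 0 < t.
Hypothesis lambda_gt0 : 0 < lambda.
Hypothesis lambda_ge : 4 * eta * Num.max
  (Num.sqrt ((t + ln (m1 + m2)%:R) / ((minn m1 m2)%:R * n%:R)))
  (2 * (t + ln (m1 + m2)%:R) / n%:R) <= lambda.

(* The Bernstein bound is optimized at theta = 2 L / s for the deviation
   s = n lambda / 2; the two lower bounds on lambda then say that the scaled
   summands have norm at most 1 and that n tau <= L. *)
Let mu : R := (m1 * m2)%:R^-1.
Let L : R := t + ln (m1 + m2)%:R.
Let theta : R := 4 * L / (n%:R * lambda).
Let tau : R := theta ^+ 2 * (eta ^+ 2 / (minn m1 m2)%:R).

Definition noise (w : T) : 'M[R]_(m1, m2) :=
  n%:R^-1 *: (\sum_(i < n) Y i w *: (X i w : 'M[R]_(m1, m2))) - mu *: A0.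

(** A function of the observed pair, since independence is a property of the pairs. Truncation and
    indicator entries keep it bounded everywhere; it is the centered [Y i w *: X i w] where [X i w]
    is a basis matrix and [Y i w] is within [eta]. *)
Definition summand (s : (borel_mx R m1 m2 * R)%type) : 'M[R]_(m1, m2) :=
  \matrix_(j, k) (truncate eta s.2 * ((s.1 : 'M[R]_(m1, m2)) == delta_mx j k)%:R)
  - mu *: A0.

Let Z (i : 'I_n) s : 'M[R]_(m1 + m2) := theta *: dilation (summand s).

Let Y_lei i : {ae P, forall w, `|Y i w| <= eta}.
Proof. by case: Y_le => B [mB PB sB]; exists B; split=> // w /= nw; apply: sB => /= /(_ i). Qed.

Let mm_gt0 : 0 < (m1 * m2)%:R :> R.
Proof. by rewrite ltr0n muln_gt0 m1_gt0. Qed.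

Let n_gt0R : 0 < n%:R :> R.
Proof. by rewrite ltr0n. Qed.

Let min_gt0 : 0 < (minn m1 m2)%:R :> R.
Proof. by rewrite ltr0n leq_min m1_gt0. Qed.

Lemma eta_ge0 : 0 <= eta.
Proof.
rewrite leNgt; apply/negP => eta0; case: Y_le => B [mB PB sB].
have : (P setT <= P B)%E.
  apply: le_measure; rewrite ?inE//; apply: subset_trans sB => w _ /= /(_ (Ordinal n_gt0)) h.
  by have := le_lt_trans (le_trans (normr_ge0 _) h) eta0; rewrite ltxx.
rewrite PB; apply/negP; rewrite -ltNge.
have h01 : (0 < 1 :> \bar R)%E by rewrite lte_fin.
exact: (eq_ind_r (fun x => (0 < x)%E) h01 (probability_setT P)).
Qed.

Lemma L_gt0 : 0 < L.
Proof.
rewrite /L ltr_pwDl// ln_ge0// -[1]/(1%:R) ler_nat.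
by rewrite (leq_trans m1_gt0)// leq_addr.
Qed.

Lemma theta_gt0 : 0 < theta.
Proof. by rewrite divr_gt0 ?mulr_gt0// L_gt0. Qed.

Lemma theta_eta : theta * (2 * eta) <= 1.
Proof.
rewrite /theta mulrAC ler_pdivrMr ?mulr_gt0// mul1r.
have h : 4 * eta * (2 * L / n%:R) <= lambda.
  apply: le_trans lambda_ge; rewrite ler_wpM2l ?mulr_ge0 ?eta_ge0//.
  by rewrite le_max lexx orbT.
move: h; rewrite mulrA ler_pdivrMr//; lra.
Qed.

Lemma tau_ge0 : 0 <= tau.
Proof. by rewrite mulr_ge0 ?sqr_ge0// divr_ge0 ?sqr_ge0. Qed.

Lemma tau_le : n%:R * tau <= L.
Proof.
have L0 := ltW L_gt0.
pose r := L / ((minn m1 m2)%:R * n%:R).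
have r0 : 0 <= r by rewrite divr_ge0// mulr_ge0.
have h : 4 * eta * Num.sqrt r <= lambda.
  apply: le_trans lambda_ge; rewrite ler_wpM2l ?mulr_ge0 ?eta_ge0//.
  by rewrite le_max lexx.
have h2 : (4 * eta * Num.sqrt r) ^+ 2 <= lambda ^+ 2.
  by rewrite lerXn2r ?nnegrE ?mulr_ge0 ?eta_ge0 ?sqrtr_ge0 ?(ltW lambda_gt0).
rewrite exprMn sqr_sqrtr// in h2.
have -> : n%:R * tau = L * ((4 * eta) ^+ 2 * r / lambda ^+ 2).
  rewrite /tau /theta /r; field.
  by rewrite !gt_eqF.
rewrite -[leRHS]mulr1 ler_wpM2l// ler_pdivrMr ?exprn_gt0// mul1r.
exact: h2.
Qed.

Let mW i : measurable_fun setT (fun w => (X i w, Y i w)).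
Proof. by apply/measurable_fun_pairP; split; exact: measurable_funPT. Qed.

Lemma bounded_truncate_snd : bounded_mfun (fun s : borel_mx R m1 m2 * R => truncate eta s.2).
Proof.
split; first by apply: (measurableT_comp (measurable_truncate _)); exact: measurable_snd.
by exists eta => s; apply: truncate_le; exact: eta_ge0.
Qed.

Lemma bounded_label_fst (j : 'I_m1) (k : 'I_m2) : bounded_mfun
  (fun s : borel_mx R m1 m2 * R => ((s.1 : 'M[R]_(m1, m2)) == delta_mx j k)%:R : R).
Proof.
pose D := (fun s : borel_mx R m1 m2 * R => s.1) @^-1` [set (delta_mx j k : 'M[R]_(m1, m2))].
have -> : (fun s : borel_mx R m1 m2 * R => ((s.1 : 'M[R]_(m1, m2)) == delta_mx j k)%:R : R) = \1_D.
  apply/funext => s; rewrite indicE /D; congr (nat_of_bool _)%:R.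
  by apply/eqP/idP => [h|]; rewrite inE.
apply: bounded_mfun_indic; rewrite /D -[_ @^-1` _]setTI.
by apply: measurable_fst => //; exact: measurable_mx1.
Qed.

Lemma bounded_summand j k : bounded_mfun (fun s => summand s j k).
Proof.
under eq_fun do rewrite !mxE.
apply: bounded_mfunB; last exact: bounded_mfun_cst.
by apply: bounded_mfunM; [exact: bounded_truncate_snd|exact: bounded_label_fst].
Qed.

Let bc i : bounded_mfun (fun w => truncate eta (Y i w)).
Proof.
apply: (@bounded_mfun_comp _ _ _ _ _ _ (Y i)) => //.
  exact: measurable_truncate.
by exists eta => y; apply: truncate_le; exact: eta_ge0.
Qed.

Let bb i j k : bounded_mfun (fun w => (label (X i) j k w)%:R : R).
Proof. by rewrite label_indic; apply: bounded_mfun_indic; exact: measurable_label. Qed.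

Let b_excl i w j k j' k' : label (X i) j k w -> label (X i) j' k' w -> j = j' /\ k = k'.
Proof. by move=> /eqP e /eqP e'; apply: (@delta_mx_inj R); rewrite -e e'. Qed.

Let meanE i : mu *: A0 = \matrix_(j, k) Ex P (fun w => truncate eta (Y i w) * (label (X i) j k w)%:R).
Proof. by apply/matrixP => j k; rewrite !mxE (Ex_truncate_label (unifX i) (condY i) (Y_lei i)). Qed.

Let summandE i w : summand (X i w, Y i w) =
  \matrix_(j, k) (truncate eta (Y i w) * (label (X i) j k w)%:R)
  - \matrix_(j, k) Ex P (fun w => truncate eta (Y i w) * (label (X i) j k w)%:R).
Proof. by rewrite -meanE. Qed.

Let summandET i w : (summand (X i w, Y i w))^T =
  \matrix_(k, j) (truncate eta (Y i w) * (label (X i) j k w)%:R)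
  - \matrix_(k, j) Ex P (fun w => truncate eta (Y i w) * (label (X i) j k w)%:R).
Proof. by rewrite summandE linearB /=; congr (_ - _); apply/matrixP => k j; rewrite !mxE. Qed.

(** On [F] the almost sure properties hold at every point, so that the sum of the truncated summands
    is exactly the rescaled noise. *)
Lemma deviation_tail (F : set T) : measurable F ->
  (forall w, F w -> forall i, `|Y i w| <= eta) ->
  (forall w, F w -> forall i, exists j k, X i w = (delta_mx j k : 'M[R]_(m1, m2))) ->
  (forall w, F w -> ~ op_bound (noise w) (lambda / 2)) ->
  (P F <= (expR (- t))%:E)%E.
Proof.
move=> mF FY FX Fbad.
have theta0 := theta_gt0.
have Zsym i s : (Z i s)^T = Z i s by rewrite /Z linearZ /= dilation_sym.
have Zbounded i a b : bounded_mfun (fun s => Z i s a b).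
  under eq_fun do rewrite /Z mxE.
  apply: bounded_mfunM; first exact: bounded_mfun_cst.
  under eq_fun do rewrite /dilation !mxE.
  case: split_ordP => a' _; under eq_fun do rewrite !mxE; case: split_ordP => b' _.
  - by under eq_fun do rewrite mxE; exact: bounded_mfun_cst.
  - exact: bounded_summand.
  - by under eq_fun do rewrite mxE; exact: bounded_summand.
  - by under eq_fun do rewrite mxE; exact: bounded_mfun_cst.
have mu_n0 : (m1 * m2)%:R != 0 :> R by rewrite gt_eqF.
have pqmu : (m1 * m2)%:R * mu = 1 by rewrite /mu divff.
have mu1 : mu <= 1 by rewrite invf_le1// -[1]/(1%:R) ler_nat muln_gt0 m1_gt0.
have eta0 := eta_ge0.
(* One [eta] for the single labelled entry and one for the mean. *)
have summand_bound s : op_bound (summand s) (2 * eta).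
  have -> : 2 * eta = eta + eta by ring.
  apply: op_boundD.
    apply: op_bound_le (op_bound_self _); apply: fro_label_le.
      exact: truncate_le.
    by move=> j k j' k' /eqP e /eqP e'; apply: (@delta_mx_inj R); rewrite -e -e'.
  apply/op_boundN; apply: op_bound_le (op_bound_self _).
  rewrite (meanE (Ordinal n_gt0)).
  apply: (fro_label_mean eta0 _ _ _ _ pqmu mu1) => //; first by move=> w; exact: truncate_le.
  by move=> j k; exact: Ex_label.
have Zle1 i s : op_bound (Z i s) 1.
  have e20 : 0 <= 2 * eta by rewrite mulr_ge0.
  have := op_boundZ theta (op_bound_dilation e20 (summand_bound s)).
  by rewrite gtr0_norm//; exact: op_bound_le theta_eta.
have Ex_summand i j k : Ex P (fun w => summand (X i w, Y i w) j k) = 0.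
  have bl : bounded_mfun (fun w => truncate eta (Y i w) * (label (X i) j k w)%:R).
    exact: bounded_mfunM.
  have -> : (fun w => summand (X i w, Y i w) j k)
      = fun w => truncate eta (Y i w) * (label (X i) j k w)%:R - mu * A0 j k.
    by apply/funext => w; rewrite !mxE.
  rewrite ExB//; last exact: bounded_mfun_cst.
  by rewrite Ex_cst (Ex_truncate_label (unifX i) (condY i) (Y_lei i)) subrr.
have bsW i j k : bounded_mfun (fun w => summand (X i w, Y i w) j k).
  by apply: (bounded_mfun_compW mW i (c := fun s => summand s j k)); exact: bounded_summand.
have Zcentered i a b : Ex P (fun w => Z i (X i w, Y i w) a b) = 0.
  under eq_fun do rewrite /Z mxE /dilation !mxE.
  case: split_ordP => a' _; under eq_fun do rewrite !mxE; case: split_ordP => b' _.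
  - by under eq_fun do rewrite mxE mulr0; exact: Ex_cst.
  - by rewrite ExZ// Ex_summand mulr0.
  - by under eq_fun do rewrite mxE; rewrite ExZ// Ex_summand mulr0.
  - by under eq_fun do rewrite mxE mulr0; exact: Ex_cst.
have Zvariance i (u : 'cV_(m1 + m2)) :
    Ex P (fun w => frobenius_norm (Z i (X i w, Y i w) *m u) ^+ 2) <= tau * frobenius_norm u ^+ 2.
  have h1 : Ex P (fun w => frobenius_norm (summand (X i w, Y i w) *m dsubmx u) ^+ 2)
      <= eta ^+ 2 * (m1%:R * mu) * frobenius_norm (dsubmx u) ^+ 2.
    under eq_fun do rewrite summandE.
    apply: (labelled_variance eta0 (bc i) _ (bb i)) => //.
    - by move=> w; exact: truncate_le.
    - exact: b_excl.
    - by move=> j k; exact: Ex_label.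
  have h2 : Ex P (fun w => frobenius_norm ((summand (X i w, Y i w))^T *m usubmx u) ^+ 2)
      <= eta ^+ 2 * (m2%:R * mu) * frobenius_norm (usubmx u) ^+ 2.
    under eq_fun do rewrite summandET.
    apply: (labelled_variance (b := fun k j => label (X i) j k) eta0 (bc i)) => //.
    - by move=> w; exact: truncate_le.
    - by move=> w k j k' j' l1 l2; have [-> ->] := b_excl l1 l2.
    - by move=> k j; exact: Ex_label.
  have le_min (p q : nat) : (0 < p)%N -> (0 < q)%N -> (minn p q <= q)%N ->
     p%:R * ((p * q)%:R)^-1 <= ((minn p q)%:R)^-1 :> R.
    move=> p0 q0 pq; have p0R : p%:R != 0 :> R by rewrite pnatr_eq0 -lt0n.
    rewrite natrM invfM mulrA divff// mul1r lef_pV2 ?posrE ?ltr0n ?leq_min ?p0 ?q0//.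
    by rewrite ler_nat.
  (* The two halves of the dilation have variance factors 1/m2 and 1/m1; the larger is the inverse
     of the minimum. *)
  have e1 : m1%:R * mu <= ((minn m1 m2)%:R)^-1 by apply: le_min => //; exact: geq_minr.
  have e2 : m2%:R * mu <= ((minn m1 m2)%:R)^-1.
    by rewrite /mu mulnC minnC; apply: le_min => //; exact: geq_minr.
  have bD : bounded_mfun (fun w => frobenius_norm (summand (X i w, Y i w) *m dsubmx u) ^+ 2).
    exact: bounded_sqr_fro_mul.
  have bDT : bounded_mfun (fun w => frobenius_norm ((summand (X i w, Y i w))^T *m usubmx u) ^+ 2).
    by apply: bounded_sqr_fro_mul => k j; under eq_fun do rewrite mxE.
  have -> : (fun w => frobenius_norm (Z i (X i w, Y i w) *m u) ^+ 2) = fun w => theta ^+ 2 *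
      (frobenius_norm (summand (X i w, Y i w) *m dsubmx u) ^+ 2
       + frobenius_norm ((summand (X i w, Y i w))^T *m usubmx u) ^+ 2).
    apply/funext => w; rewrite /Z -scalemxAl froZ exprMn sqr_fro_dilation_mul.
    by rewrite gtr0_norm.
  rewrite ExZ ?ExD//; last exact: bounded_mfunD.
  rewrite /tau -mulrA ler_wpM2l ?sqr_ge0// sqr_fro_vsubmx.
  have q1 := sqr_ge0 (frobenius_norm (usubmx u)); have q2 := sqr_ge0 (frobenius_norm (dsubmx u)).
  have q3 := sqr_ge0 eta.
  have f1 := ler_wpM2r q2 (ler_wpM2l q3 e1); have f2 := ler_wpM2r q1 (ler_wpM2l q3 e2).
  by rewrite mulrDr addrC; apply: lerD; [exact: le_trans f2|exact: le_trans f1].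
have L2 : 0 <= 2 * L by rewrite mulr_ge0// ltW// L_gt0.
have sumE w : F w -> partial_sum (fun i w => (X i w, Y i w)) Z n w
    = (theta * n%:R) *: dilation (noise w).
  move=> Fw; rewrite -scalerA -dilationZ.
  have -> : n%:R *: noise w = \sum_(i < n) summand (X i w, Y i w).
    rewrite /noise scalerBr scalerA divff ?gt_eqF// scale1r.
    have -> : n%:R *: (mu *: A0) = \sum_(i < n) mu *: A0.
      by rewrite sumr_const card_ord scaler_nat.
    rewrite -sumrB; apply: eq_bigr => i _; rewrite /summand /=; congr (_ - _).
    have [j [k ->]] := FX w Fw i; rewrite truncate_id ?FY//.
    apply/matrixP => a b; rewrite !mxE; congr (_ * (nat_of_bool _)%:R).
    apply/idP/eqP => [/andP[/eqP -> /eqP ->] //|/(@delta_mx_inj R)[-> ->]].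
    by rewrite !eqxx.
  rewrite dilation_sum scaler_sumr /partial_sum.
  by apply: eq_big => i; rewrite ?ltn_ord.
have nquad w : F w -> ~ forall u : 'cV_(m1 + m2), inner_mx u
    (partial_sum (fun i w => (X i w, Y i w)) Z n w *m u) <= 2 * L * frobenius_norm u ^+ 2.
  move=> Fw q.
  apply: (Fbad w Fw); apply: op_bound_of_dilation => u; have := q u; rewrite sumE//.
  have tn0 : 0 < theta * n%:R by rewrite mulr_gt0.
  rewrite -scalemxAl innerZr => h; rewrite -(ler_pM2l tn0); apply: le_trans h _.
  have e : 2 * L = theta * n%:R * (lambda / 2).
    by rewrite /theta; field; rewrite !gt_eqF.
  by rewrite [leRHS]mulrA -e.
have main := matrix_bernstein mW indepXY Zsym Zbounded Zle1 Zcentered tau_ge0 Zvariance L2 mF nquad.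
rewrite -(fineK (fin_num_measure P _ mF)) lee_fin.
rewrite -(ler_pM2r (expR_gt0 (2 * L))); apply: le_trans main _.
rewrite -expRD.
(* The exponent 2 L pays L for the variance, and the remaining L = t + ln (m1 + m2) pays for the
   dimension and leaves t. *)
have tau1 : (1 + tau) ^+ n <= expR L.
  apply: (@le_trans _ _ (expR tau ^+ n)).
    by rewrite lerXn2r ?nnegrE ?expR_ge0 ?expR_ge1Dx// addr_ge0// tau_ge0.
  by rewrite -expRM_natl ler_expR tau_le.
have m0 : 0 < (m1 + m2)%:R :> R by rewrite ltr0n addn_gt0 m1_gt0.
rewrite -[(m1 + m2)%:R]lnK ?posrE//.
apply: (@le_trans _ _ (expR L * expR (ln (m1 + m2)%:R))).
  by rewrite ler_wpM2r ?expR_ge0.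
by rewrite -expRD ler_expR /L; lra.
Qed.


End Deviation.

(** * Measurability of the oracle event and its probability *)

Unset Implicit Arguments.

Theorem theorem4 (R : realType) (d : measure_display) (T : measurableType d)
    (P : probability T R) (m1 m2 n : nat)
    (X : 'I_n -> {RV P >-> borel_mx R m1 m2}) (Y : 'I_n -> {RV P >-> R})
    (A0 : 'M[R]_(m1, m2)) (eta t lambda : R) (Ahat : T -> 'M[R]_(m1, m2)) :
  (0 < m1)%N -> (0 < m2)%N -> (0 < n)%N ->
  mutually_independent P (fun i w => (X i w, Y i w)) ->
  (forall i, uniform_on_canonical_basis (X i)) ->
  (forall i, is_cond_expectation P (Y i) (X i)
     (fun x : borel_mx R m1 m2 => \tr ((x : 'M[R]_(m1, m2))^T *m A0))) ->
  {ae P, forall w, forall i, `|Y i w| <= eta} ->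
  0 < t ->
  0 < lambda ->
  4 * eta * Num.max
      (Num.sqrt ((t + ln (m1 + m2)%:R) / ((minn m1 m2)%:R * n%:R)))
      (2 * (t + ln (m1 + m2)%:R) / n%:R) <= lambda ->
  (forall w, is_minimizer
     (penalized_risk lambda (fun i => X i w) (fun i => Y i w)) (Ahat w)) ->
  let E := [set w | forall A : 'M[R]_(m1, m2),
    frobenius_norm (Ahat w - A0) ^+ 2 <=
      frobenius_norm (A - A0) ^+ 2 +
      (m1 * m2)%:R * Num.min
        (2 * lambda * nuclear_norm A)
        (((1 + Num.sqrt 2) / 2) ^+ 2 * (m1 * m2)%:R * lambda ^+ 2
           * (\rank A)%:R)] in
  measurable E /\ ((1 - expR (- t))%:E <= P E)%E.
Proof.
move=> m1_gt0 m2_gt0 n_gt0 indepXY unifX condY Y_le t_gt0 lambda_gt0 lambda_ge Amin E.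
pose mu : R := (m1 * m2)%:R^-1.
have mm0 : 0 < (m1 * m2)%:R :> R by rewrite ltr0n muln_gt0 m1_gt0.
have mu0 : 0 < mu by rewrite invr_gt0.
pose G w : 'M[R]_(m1, m2) := (2 / n%:R) *: \sum_(i < n) Y i w *: (X i w : 'M[R]_(m1, m2)).
have Gmin w : is_minimizer (risk mu (G w) lambda) (Ahat w) by exact: Amin.
have mG j k : measurable_fun setT (fun w => G w j k).
  under eq_fun do rewrite mxE summxE.
  apply: measurable_funM => //; apply: measurable_sum => i.
  under eq_fun do rewrite mxE.
  apply: measurable_funM; first exact: measurable_funPT.
  exact: (measurableT_comp (measurable_coord j k) (measurable_funPT (X i))).
(* Ahat is a Lipschitz function of the random matrix G, and E is closed in Ahat. *)
have mE : measurable E.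
  apply: (measurable_of_approx mG) => w approx A /=.
  set c := (X in _ <= X); set h := frobenius_norm _.
  have h0 : 0 <= h by exact: fro_ge0.
  have C0 : 0 < (2 * mu)^-1 by rewrite invr_gt0 mulr_gt0.
  have hle e : 0 < e -> h <= Num.sqrt c + e.
    (* The tolerance on [G] is [e] divided by the Lipschitz constant [(2 * mu)^-1] of the
       minimizer. *)
    move=> e0; have [|w' Ew' ww'] := approx (e * (2 * mu)); first by rewrite !mulr_gt0.
    have Ec : frobenius_norm (Ahat w' - A0) <= Num.sqrt c.
      rewrite -[leLHS]ger0_norm ?fro_ge0// -sqrtr_sqr ler_wsqrtr//.
      exact: Ew'.
    have lip := minimizer_lipschitz mu0 (ltW lambda_gt0) (Gmin w') (Gmin w).
    have : frobenius_norm (Ahat w - Ahat w') <= e.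
      apply: le_trans lip _; rewrite ler_pdivrMl ?mulr_gt0//.
      by rewrite mulrC.
    have := ler_froD (Ahat w - Ahat w') (Ahat w' - A0).
    by rewrite addrA subrK -/h; lra.
  (* Read off from a nearby point of [E], where [c] dominates a square. *)
  have c0 : 0 <= c.
    have [|w' Ew' _] := approx 1; first by [].
    exact: le_trans (sqr_ge0 _) (Ew' A).
  have hc : h <= Num.sqrt c by apply/ler_addgt0Pr.
  by rewrite -(sqr_sqrtr c0) lerXn2r ?nnegrE ?sqrtr_ge0.
split=> //.
case: Y_le => B [mB PB sB].
have /choice[B' hB'] : forall i, exists B', [/\ measurable B', P B' = 0%E &
    ~` [set w | exists j k, X i w = (delta_mx j k : 'M[R]_(m1, m2))] `<=` B'].
  by move=> i; have [B' [h1 h2 h3]] := ae_basis (unifX i); exists B'.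
(* The [n] null sets are extended by empty sets to a sequence, for countable subadditivity. *)
pose B'' k := oapp B' set0 (insub k : option 'I_n).
pose N := B `|` \bigcup_k B'' k.
have mB'' k : measurable (B'' k).
  by rewrite /B''; case: insubP => [i _ _|_] /=; [have [] := hB' i|exact: measurable0].
have mN' : measurable (\bigcup_k B'' k) by exact: bigcupT_measurable.
have mN : measurable N by exact: measurableU.
have PN' : P (\bigcup_k B'' k) = 0%E.
  apply/negligibleP => //; apply: negligible_bigcup => k; apply/negligibleP => //.
  by rewrite /B''; case: insubP => [i _ _|_] /=; [have [] := hB' i|exact: measure0].
have PN : P N = 0%E.
  by apply/negligibleP => //; apply: negligibleU; apply/negligibleP.
have mF : measurable (~` E `\` N) by apply: measurableD => //; exact: measurableC.
have PF : (P (~` E `\` N) <= (expR (- t))%:E)%E.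
  have nN w : (~` E `\` N) w -> ~ N w by move=> [].
  apply: (deviation_tail m1_gt0 m2_gt0 n_gt0 indepXY unifX condY _ t_gt0 lambda_gt0 lambda_ge mF).
  - by exists B.
  - move=> w /nN nw i; apply: contrapT => h; apply: nw; left; apply: sB => /= h'.
    exact: h.
  - move=> w /nN nw i; apply: contrapT => h; apply: nw; right; exists i => //.
    by rewrite /B'' valK /=; have [_ _] := hB' i; apply.
  - move=> w [nE _] Mle; apply: nE => A /=.
    have GE : G w = 2 *: (mu *: A0 + noise X Y A0 w).
      by rewrite /noise addrC subrK scalerA.
    have Gm := Gmin w; rewrite GE in Gm.
    have := oracle_inequality mu0 lambda_gt0 Mle Gm A.
    by rewrite invrK.
have PEc : (P (~` E) <= (expR (- t))%:E)%E.
  apply: (@le_trans _ _ (P (~` E `\` N) + P N)%E); last by rewrite PN adde0.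
  apply: le_trans (measureU2 _ _ _) => //; apply: le_measure; rewrite ?inE//; [exact: measurableC|exact: measurableU|].
  by move=> w nE; have [?|?] := pselect (N w); [right|left].
have -> : E = ~` (~` E) by rewrite setCK.
rewrite probability_setC; last exact: measurableC.
rewrite EFinB; exact: leeB.
Qed.
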